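(* There is an algorithm which, given a pathograph $\mathfrak{H}$ with no rungs and a finite set $\mathcal{F}$ of pathographs, decides whether there exists an $\mathcal{F}$-free realization of $\mathfrak{H}$.
   Context: All graphs are finite and simple. A pathograph is a tuple $\mathfrak{G}=(V,U,E,S,R,\pi)$ where $V$ (vertices) and $U$ (urpaths) are finite disjoint sets, $E\subseteq\binom{V}{2}$ (edges), $S\subseteq V\times U$ (spokes), $R\subseteq\binom{U}{2}$ (rungs), and $\pi:U\to\binom{V}{2}$ assigns to each urpath its two distinct endpoints, with $\pi(U)\cap E=\emptyset$. A graph is regarded as a pathograph with no urpaths, spokes or rungs. A realization of $\mathfrak{G}$ is a graph obtained as follows: start from the graph $(V,E)$; for each urpath $u$ with endpoints $a,b$ add new vertices $x_u^{(1)},\dots,x_u^{(m_u)}$ ($m_u\ge 1$, the internal vertices of $u$) and the edges of the path $a x_u^{(1)}\cdots x_u^{(m_u)} b$; the only further edges added are: for each spoke $(v,u)\in S$, a nonempty set of edges between $v$ and internal vertices of $u$; and for each rung $\{u,u'\}\in R$, a nonempty set of edges between internal vertices of $u$ and internal vertices of $u'$. A graph $G$ contains a pathograph $\mathfrak{F}$ if some induced subgraph of $G$ is isomorphic to a realization of $\mathfrak{F}$; for a set $\mathcal{F}$ of pathographs, $G$ is $\mathcal{F}$-free if it contains no member of $\mathcal{F}$. *)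

(* Defs.v *)
From Stdlib Require List.
From mathcomp Require Import all_boot.
Unset Printing Implicit Defensive.

(* Pathographs, concretely: vertices are 0..nV-1, urpaths 0..nU-1.    *)
(*  pg_edges  : list of (unordered) pairs of vertices  (E)            *)
(*  pg_spokes : list of pairs (v,u), v vertex, u urpath (S)           *)
(*  pg_rungs  : list of (unordered) pairs of urpaths   (R)            *)
(*  pg_ends   : the u-th entry is the endpoint pair pi(u) of u        *)
(* Duplicates/orderings in the lists are irrelevant (set semantics).  *)
Record pathograph := Pathograph {
  pg_nV : nat; pg_nU : nat;
  pg_edges : seq (nat * nat);
  pg_spokes : seq (nat * nat);
  pg_rungs : seq (nat * nat);
  pg_ends : seq (nat * nat) }.

Definition is_edge (P : pathograph) (a b : nat) : bool :=
  ((a, b) \in pg_edges P) || ((b, a) \in pg_edges P).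
Definition is_spoke (P : pathograph) (v u : nat) : bool := (v, u) \in pg_spokes P.
Definition is_rung (P : pathograph) (u u' : nat) : bool :=
  ((u, u') \in pg_rungs P) || ((u', u) \in pg_rungs P).
Definition end1 (P : pathograph) (u : nat) : nat := (nth (0, 0) (pg_ends P) u).1.
Definition end2 (P : pathograph) (u : nat) : nat := (nth (0, 0) (pg_ends P) u).2.

Definition wf_pg (P : pathograph) : bool :=
  [&& all (fun p => [&& p.1 < pg_nV P, p.2 < pg_nV P & p.1 != p.2]) (pg_edges P),
      all (fun p => (p.1 < pg_nV P) && (p.2 < pg_nU P)) (pg_spokes P),
      all (fun p => [&& p.1 < pg_nU P, p.2 < pg_nU P & p.1 != p.2]) (pg_rungs P),
      size (pg_ends P) == pg_nU P,
      all (fun p => [&& p.1 < pg_nV P, p.2 < pg_nV P & p.1 != p.2]) (pg_ends P) &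
      all (fun p => ~~ is_edge P p.1 p.2) (pg_ends P)].

(* Vertex set of a realization with path lengths given by m: the      *)
(* urpath u receives the m u + 1 (>= 1) internal vertices (u,0..m u), *)
(* traversed from end1 u to end2 u.                                   *)
Definition rvert (P : pathograph) (m : 'I_(pg_nU P) -> nat) : Type :=
  ('I_(pg_nV P) + {u : 'I_(pg_nU P) & 'I_(m u).+1})%type.

Definition base_adj (P : pathograph) (m : 'I_(pg_nU P) -> nat)
    (x y : rvert P m) : bool :=
  match x, y with
  | inl a, inl b => is_edge P a b
  | inl a, inr (existT u i) | inr (existT u i), inl a =>
      ((a == end1 P u :> nat) && (i == 0 :> nat))
      || ((a == end2 P u :> nat) && (i == m u :> nat))
  | inr (existT u i), inr (existT u' j) =>
      (u == u') && ((i.+1 == j :> nat) || (j.+1 == i :> nat))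
  end.

Definition extra_ok (P : pathograph) (m : 'I_(pg_nU P) -> nat)
    (x y : rvert P m) : bool :=
  match x, y with
  | inl _, inl _ => false
  | inl a, inr (existT u _) | inr (existT u _), inl a => is_spoke P a u
  | inr (existT u _), inr (existT u' _) => is_rung P u u'
  end.

Definition is_realization (P : pathograph) (m : 'I_(pg_nU P) -> nat)
    (r : rel (rvert P m)) : Prop :=
  [/\ (forall x y, r x y = r y x) /\ (forall x, ~~ r x x),
      (forall x y, base_adj P m x y -> r x y),
      (forall x y, r x y -> base_adj P m x y || extra_ok P m x y),
      (forall (v : 'I_(pg_nV P)) (u : 'I_(pg_nU P)), is_spoke P v u ->
         exists i : 'I_(m u).+1,
           r (inl v) (inr (existT _ u i)) && ~~ base_adj P m (inl v) (inr (existT _ u i))) &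
      (forall u u' : 'I_(pg_nU P), is_rung P u u' ->
         exists (i : 'I_(m u).+1) (j : 'I_(m u').+1),
           r (inr (existT _ u i)) (inr (existT _ u' j)))].

Definition contains (T : Type) (e : rel T) (Q : pathograph) : Prop :=
  exists (m : 'I_(pg_nU Q) -> nat) (r : rel (rvert Q m)),
    is_realization Q m r /\
    exists f : rvert Q m -> T, injective f /\ forall x y, e (f x) (f y) = r x y.

Definition Ffree (T : Type) (e : rel T) (F : seq pathograph) : Prop :=
  forall Q, List.In Q F -> ~ contains T e Q.

Definition has_Ffree_realization (H : pathograph) (F : seq pathograph) : Prop :=
  exists (m : 'I_(pg_nU H) -> nat) (r : rel (rvert H m)),
    is_realization H m r /\ Ffree (rvert H m) r F.


Inductive prf : Type :=
| PZero
| PSucc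
| PProj (i : nat)
| PComp (f : prf) (gs : seq prf)
| PPrimRec (f g : prf)
| PMin (f : prf).

Inductive eval : prf -> seq nat -> nat -> Prop :=
| ev_zero xs : eval PZero xs 0
| ev_succ x xs : eval PSucc (x :: xs) x.+1
| ev_proj i xs : eval (PProj i) xs (nth 0 xs i)
| ev_comp f gs xs ys y : evals gs xs ys -> eval f ys y -> eval (PComp f gs) xs y
| ev_rec0 f g xs y : eval f xs y -> eval (PPrimRec f g) (0 :: xs) y
| ev_recS f g n xs r y : eval (PPrimRec f g) (n :: xs) r ->
    eval g [:: n, r & xs] y -> eval (PPrimRec f g) (n.+1 :: xs) y
| ev_min f xs n : eval f (n :: xs) 0 ->
    (forall k, k < n -> exists z, eval f (k :: xs) z.+1) -> eval (PMin f) xs n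
with evals : seq prf -> seq nat -> seq nat -> Prop :=
| evs_nil xs : evals [::] xs [::]
| evs_cons g gs xs y ys : eval g xs y -> evals gs xs ys -> evals (g :: gs) xs (y :: ys).

Definition pg_data (P : pathograph) :=
  (pg_nV P, pg_nU P, pg_edges P, pg_spokes P, pg_rungs P, pg_ends P).
Definition pg_code (P : pathograph) : nat := pickle (pg_data P).
Definition pg_codes (F : seq pathograph) : nat := pickle (map pg_code F).

(* Main.v *)
Require Import Defs.
From mathcomp Require Import all_boot zify.
Set Implicit Arguments.
Unset Strict Implicit.

(** Without rungs, a realization of [H] is a tuple of words, one per urpath, whose
    letters record the neighbours of an internal vertex among the vertices of [H].
    Inside such a graph every realization of [Q] runs monotonically along the words
    except at boundedly many marked positions, so whether [Q] is contained depends
    only on which letters occur at the marks and in the gaps between them, over all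
    placements of at most [N] marks.  This information (the profile of a word) takes
    finitely many values and is compatible with concatenation, so long words can be
    pumped down: if an [F]-free realization exists, one exists with path lengths
    below a computable bound, and a bounded search decides the problem. *)

(** * Words, marks and profiles *)

(** A rung of [H] would let internal vertices have neighbours in another word, out of reach of a
    fixed alphabet. Rungs in members of [F] cost only two marks each, since one edge witnesses a
    rung. The main obstacle is that a realization of [Q] has path lengths of its own, unrelated to
    those of the host graph. Containment is therefore restated as a colouring of the host ([layout])
    in which lengths do not occur. Its existential clauses are witnessed at marks. Its universal
    clauses must hold at every new position, so each letter in a gap of one word has to occur in the
    corresponding gap of the other, and colours have to be constant on gaps. Each letter also
    carries two flags, first and last, because an edge to an endpoint of an urpath is a path edge at
    the corresponding extremity and a spoke edge elsewhere. Since an algorithm here is a recursive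
    function on numbers, the bounded search is finally rewritten on codes, using primitive recursion
    only. *)

Fixpoint rank (M : nat -> bool) (i : nat) : nat :=
  if i is j.+1 then rank M j + M j else 0.

Lemma leq_rank (M : nat -> bool) i j : i <= j -> rank M i <= rank M j.
Proof.
elim: j => [|j IH]; first by rewrite leqn0 => /eqP->.
rewrite leq_eqVlt => /predU1P[-> //|]; rewrite ltnS => /IH /=; lia.
Qed.

Lemma eq_rank (M M' : nat -> bool) i : (forall j, j < i -> M j = M' j) -> rank M i = rank M' i.
Proof.
elim: i => //= i IH eqM; rewrite IH ?eqM // => j ltji; apply: eqM; lia.
Qed.

Lemma rank_mark_inj (M : nat -> bool) i j : M i -> M j -> rank M i = rank M j -> i = j.
Proof.
move=> Mi Mj eq_r; case: (ltngtP i j) => // lt_ij.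
  by move: (leq_rank M lt_ij); rewrite /= Mi; lia.
by move: (leq_rank M lt_ij); rewrite /= Mj; lia.
Qed.

(** Gaps are intervals: a mark between [i] and [k] would raise the rank. *)
Lemma rank_between (M : nat -> bool) i j k :
  rank M i = rank M k -> M k = false -> i <= j <= k -> rank M j = rank M k /\ M j = false.
Proof.
move=> eq_r nMk /andP[le_ij le_jk].
have le1 := leq_rank M le_ij; have le2 := leq_rank M le_jk.
have eqj : rank M j = rank M k by lia.
split=> //; case Mj: (M j) => //.
move: le_jk; rewrite leq_eqVlt => /predU1P[eqjk|lt_jk]; first by rewrite eqjk nMk in Mj.
by move: (leq_rank M lt_jk); rewrite /= Mj; lia.
Qed.

Section Profile.

Variables (A : finType) (N : nat).

(* The [rank] of a position counts the marks before it, so the pairs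
   (rank, marked?) enumerate the marks and the gaps between them. *)
Definition summary (M : nat -> bool) (w : seq A) : {set 'I_N.+1 * bool * A} :=
  [set t : 'I_N.+1 * bool * A | has (fun i => [&& rank M i == t.1.1, M i == t.1.2 & onth w i == Some t.2])
               (iota 0 (size w))].

Lemma summaryP M w (k : 'I_N.+1) b a :
  reflect (exists i, [/\ rank M i = k, M i = b & onth w i = Some a])
          ((k, b, a) \in summary M w).
Proof.
rewrite inE; apply: (iffP hasP) => [[i _ /and3P[/eqP e1 /eqP e2 /eqP e3]]|[i [e1 e2 e3]]].
  by exists i.
exists i; last by rewrite e1 e2 e3 !eqxx.
by rewrite mem_iota /= add0n -onthTE e3.
Qed.

Lemma eq_summary M M' w :
  (forall i, i < size w -> M i = M' i) -> summary M w = summary M' w.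
Proof.
move=> eqM; apply/setP=> t; rewrite !inE; apply: eq_in_has => i.
rewrite mem_iota /= add0n => lti; rewrite eqM // (@eq_rank M M') // => j ltj.
by apply: eqM; apply: ltn_trans lti.
Qed.

(** The total number of marks is kept beside the summary because it is the rank that an appended
    letter receives. Its range ['I_N.+1] limits the markings to at most [N] marks. *)
Definition profile (w : seq A) : {set 'I_N.+1 * {set 'I_N.+1 * bool * A}} :=
  [set kS : 'I_N.+1 * {set 'I_N.+1 * bool * A} | [exists M : (size w).-tuple bool,
     (rank (nth false M) (size w) == kS.1) && (summary (nth false M) w == kS.2)]].

Lemma profileP w (k : 'I_N.+1) S :
  reflect (exists M, rank M (size w) = k /\ summary M w = S) ((k, S) \in profile w).
Proof.
rewrite inE; apply: (iffP existsP) => [[M /andP[/eqP e1 /eqP e2]]|[M [e1 e2]]].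
  by exists (nth false M).
exists [tuple M i | i < size w].
have eqM i : i < size w -> nth false [tuple M i | i < size w] i = M i.
  by move=> lti; have := nth_mktuple (fun i : 'I_(size w) => M i) false (Ordinal lti).
by rewrite (eq_rank eqM) (eq_summary eqM) e1 e2 !eqxx.
Qed.

Lemma onth_rcons (w : seq A) a i :
  onth (rcons w a) i =
  if i < size w then onth w i else if i == size w then Some a else None.
Proof.
rewrite -cats1 onth_cat; case: ltnP => // le_i; case: eqP => [->|ne].
  by rewrite subnn.
by rewrite onth_default //=; lia.
Qed.

Lemma summary_rcons M w a (lt_k : rank M (size w) < N.+1) :
  summary M (rcons w a) = (Ordinal lt_k, M (size w), a) |: summary M w.
Proof.
apply/setP=> -[[k b] c]; rewrite in_setU1; apply/summaryP/predU1P.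
  case=> i []; rewrite onth_rcons; case: ltnP => [lti e1 e2 e3|_ e1 e2].
    by right; apply/summaryP; exists i.
  case: eqP => // ei [<-]; left; subst i.
  by congr (_, _, _); [apply: val_inj | ].
case=> [[ek -> ->]|/summaryP[i [e1 e2 e3]]].
  by exists (size w); rewrite onth_rcons ltnn eqxx ek.
by exists i; rewrite onth_rcons -onthTE e3.
Qed.

(** An appended letter adds one triple to the summary, built from the number of earlier marks and
    its own mark; both can be copied from one word to the other. *)
Lemma profile_rcons x y a :
  profile x \subset profile y -> profile (rcons x a) \subset profile (rcons y a).
Proof.
move=> sub; apply/subsetP=> -[k S] /profileP[M []]; rewrite size_rcons /= => ek eS.
have ltk : rank M (size x) < N.+1 by have := ltn_ord k; lia.
have /(subsetP sub)/profileP[M0 [ek0 eS0]] : (Ordinal ltk, summary M x) \in profile x.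
  by apply/profileP; exists M.
pose M1 j := if j == size y then M (size x) else M0 j.
have eqM j : j < size y -> M1 j = M0 j by rewrite /M1; case: eqP => // ->; rewrite ltnn.
have M1y : M1 (size y) = M (size x) by rewrite /M1 eqxx.
have r1 : rank M1 (size y) = rank M (size x) by rewrite (eq_rank eqM) ek0.
have ltk1 : rank M1 (size y) < N.+1 by rewrite r1.
apply/profileP; exists M1; rewrite size_rcons /= M1y r1 ek; split=> //.
rewrite (summary_rcons _ ltk1) (eq_summary eqM) eS0 -eS (summary_rcons _ ltk) M1y.
by congr ((_, _, _) |: _); apply: val_inj.
Qed.

Lemma profile_cat x y z :
  profile x \subset profile y -> profile (x ++ z) \subset profile (y ++ z).
Proof.
move=> sub; elim/last_ind: z => [|z a IH]; first by rewrite !cats0.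
by rewrite -!rcons_cat; apply: profile_rcons.
Qed.

(** Positions correspond by letter and block only; inside a gap neither order nor multiplicity is
    retained, which leaves room for shortening. *)
Definition aligned (M : nat -> bool) (w : seq A) (M' : nat -> bool) (w' : seq A) :=
  forall i a, onth w i = Some a ->
  exists i', [/\ onth w' i' = Some a, rank M' i' = rank M i & M' i' = M i].

Lemma profile_aligned M' w w' :
    profile w' \subset profile w -> rank M' (size w') <= N ->
  exists M, aligned M w M' w' /\ aligned M' w' M w.
Proof.
move=> sub leN; have ltN : rank M' (size w') < N.+1 by [].
have /(subsetP sub)/profileP[M [eM eS]] : (Ordinal ltN, summary M' w') \in profile w'.
  by apply/profileP; exists M'.
exists M; split=> i a ea.
  have lti : i < size w by rewrite -onthTE ea.
  have ltk : rank M i < N.+1.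
    by have := leq_rank M (ltnW lti); move: eM => /=; lia.
  have : (Ordinal ltk, M i, a) \in summary M w by apply/summaryP; exists i.
  by rewrite eS => /summaryP[i' [e1 e2 e3]]; exists i'.
have lti : i < size w' by rewrite -onthTE ea.
have ltk : rank M' i < N.+1 by have := leq_rank M' (ltnW lti); lia.
have : (Ordinal ltk, M' i, a) \in summary M' w' by apply/summaryP; exists i.
by rewrite -eS => /summaryP[i' [e1 e2 e3]]; exists i'.
Qed.

End Profile.

(** * Pumping words down by the pigeonhole principle *)

Section Shrink.

Variables (L : finType) (N : nat).
Local Notation A := (L * (bool * bool))%type.

(** The flags let a letter alone decide which of its edges to [H] are path edges. *)
Definition flagged (w : seq A) :=
  forall i a, onth w i = Some a -> a.2 = (i == 0, i.+1 == size w).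

Definition profile_count (a : nat) := 2 ^ (N.+1 * 2 ^ (N.+1 * 2 * a)).

Lemma card_profile : #|{: {set 'I_N.+1 * {set 'I_N.+1 * bool * A}}}| = profile_count #|{: A}|.
Proof.
have cset (T : finType) : #|{: {set T}}| = 2 ^ #|T|.
  by rewrite -[#|T|]cardsT -card_powerset powersetT cardsT.
by rewrite cset card_prod cset card_prod card_prod card_ord card_bool.
Qed.

Lemma onth_take (T : Type) (w : seq T) n i : i < n -> onth (take n w) i = onth w i.
Proof. by elim: n w i => [|n IH] [|x w] [|i] //= lt; apply: IH. Qed.

Lemma onth_drop (T : Type) (w : seq T) n i : onth (drop n w) i = onth w (n + i).
Proof. by elim: n w i => [|n IH] [|x w] i //=; rewrite ?onth0n. Qed.

(* Two prefixes with the same profile are exchangeable; the first and the last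
   letter are kept so that the flags stay correct. *)
Lemma shrink (w : seq A) : 0 < size w -> flagged w ->
  exists w', [/\ 0 < size w' <= (profile_count #|{: A}|).+1, flagged w' &
                 profile N w' = profile N w].
Proof.
have [n] := ubnP (size w); elim: n w => // n IH w; rewrite ltnS => lewn w0 fw.
have [small|large] := leqP (size w) (profile_count #|{: A}|).+1.
  by exists w; rewrite w0 small.
(* Only the [(size w).-1] nonempty proper prefixes compete, hence the successor in the length
   bound. *)
pose f (i : 'I_(size w).-1) := profile N (take i.+1 w).
have /injectivePn[i0 [j0 ne_ij eq_ij]] : ~~ injectiveb f.
  by apply/negP => /injectiveP/leq_card; rewrite card_profile card_ord; lia.
wlog lt_ij : i0 j0 ne_ij eq_ij / i0 < j0.
  move=> Hw; case: (ltngtP i0 j0) => [lt|lt|/val_inj eq]; first exact: (Hw i0 j0).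
    by apply: (Hw j0 i0); rewrite // eq_sym.
  by rewrite eq eqxx in ne_ij.
have ltj := ltn_ord j0.
pose w1 := take i0.+1 w ++ drop j0.+1 w.
have sz1 : size (take i0.+1 w) = i0.+1 by rewrite size_takel //; lia.
have szw1 : size w1 = i0.+1 + (size w - j0.+1) by rewrite size_cat sz1 size_drop.
have pw1 : profile N w1 = profile N w.
  have pij : profile N (take i0.+1 w) = profile N (take j0.+1 w) by [].
  rewrite -[in RHS](cat_take_drop j0.+1 w).
  by apply/eqP; rewrite eqEsubset !profile_cat ?pij.
have fw1 : flagged w1.
  move=> k a; rewrite /w1 onth_cat sz1; case: ltnP => [ltk|lek].
    rewrite onth_take // => /fw ->; congr (_, _); rewrite szw1.
    by apply/eqP/eqP; lia.
  rewrite onth_drop => /fw ->; rewrite szw1; congr (_, _); first by apply/eqP/eqP; lia.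
  by apply/eqP/eqP; lia.
have [||w' [szw' fw' pw']] := IH w1 _ _ fw1; [lia|lia|].
by exists w'; rewrite pw' pw1.
Qed.

End Shrink.

(* Consecutive positions lie in the same gap or in neighbouring blocks (marks or
   gaps), and which blocks are neighbours depends only on the nonempty ones. *)
Lemma aligned_succ (A : finType) (M M' : nat -> bool) (w w' : seq A) i :
    aligned M w M' w' -> aligned M' w' M w -> i.+1 < size w ->
    (rank M i, M i) <> (rank M i.+1, M i.+1) ->
  exists i', [/\ i'.+1 < size w', (rank M' i', M' i') = (rank M i, M i) &
                 (rank M' i'.+1, M' i'.+1) = (rank M i.+1, M i.+1)].
Proof.
move=> al al' lti ne.
have ex (N1 N2 : nat -> bool) (v1 v2 : seq A) : aligned N1 v1 N2 v2 ->
    forall k, k < size v1 ->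
    exists k', [/\ k' < size v2, rank N2 k' = rank N1 k & N2 k' = N1 k].
  move=> aln k; rewrite -onthTE; case E: (onth v1 k) => [a|] // _.
  by have [k' [e1 e2 e3]] := aln _ _ E; exists k'; split=> //; rewrite -onthTE e1.
have [j [ltj rj Mj]] := ex _ _ _ _ al i (ltnW lti).
have [k [ltk rk Mk]] := ex _ _ _ _ al _ lti.
(* For a marked [i] the witness is its match [j]; it remains to identify the block of [j.+1]. *)
case Mi: (M i) in ne Mj.
  have ltjk : j < k.
    by rewrite ltnNge; apply/negP=> /(leq_rank M'); rewrite rj rk /= Mi; lia.
  exists j; rewrite rj Mj /= rj Mj Mi; split=> //; first lia.
  congr (_, _); rewrite -Mk.
  case: (ltngtP j.+1 k) => [lt||<- //]; last by lia.
  have := leq_rank M' lt; rewrite /= rk /= Mj Mi rj => le1.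
  case Mj1: (M' j.+1); first by move: le1; rewrite Mj1; lia.
  case Mk1: (M' k) => //.
  (* An unmarked [j.+1] before a marked [k] would lie in a gap between these two marks; the reverse
     alignment would then put a position of [w] strictly between [i] and [i.+1]. *)
  have [j' [lt' r' M1']] := ex _ _ _ _ al' j.+1 (leq_ltn_trans ltjk ltk).
  move: r'; rewrite /= rj Mj => r'.
  have lt_ij' : i < j'.
    by rewrite ltnNge; apply/negP=> /(leq_rank M); rewrite r'; lia.
  move: lt_ij'; rewrite leq_eqVlt => /predU1P[e|lt_ij'].
    by rewrite -e Mj1 -Mk Mk1 in M1'.
  by have := leq_rank M lt_ij'; rewrite r' /= Mi -Mk Mk1; lia.
(* From an unmarked [i] the block changes only by meeting a mark, so [i.+1] is marked and the
   witness is the position just before its match [k]. *)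
have Mi1 : M i.+1 by case E: (M i.+1) => //; case: ne; rewrite /= Mi E addn0.
move: rk; rewrite /= Mi addn0 => rk.
have ltjk : j < k.
  rewrite ltn_neqAle; apply/andP; split.
    by apply/eqP=> e; rewrite e Mk Mi1 in Mj.
  rewrite leqNgt; apply/negP=> lt; have := leq_rank M' lt.
  by rewrite /= rj rk Mk Mi1; lia.
case: k => // k in ltk rk Mk ltjk *.
have := leq_rank M' ltjk; move: rk => /= rk.
have := leq_rank M' (ltjk : j <= k); rewrite rj => le1 le2.
have nMk : M' k = false by case E: (M' k) => //; move: rk; rewrite E; lia.
exists k; split=> //; rewrite ?nMk ?Mi /= ?Mi ?Mk; congr (_, _); move: rk; rewrite nMk; lia.
Qed.

(** * Layouts of a pathograph in a graph *)

(** Plain numbers as positions allow arithmetic on indices; out of range [inord] falls back to 0,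
    hence the conditions [i <= m u] throughout. *)
Definition rpos (P : pathograph) (m : 'I_(pg_nU P) -> nat) (u : 'I_(pg_nU P)) (i : nat) :
  rvert P m := inr (existT _ u (inord i)).

Variant rvert_spec (P : pathograph) (m : 'I_(pg_nU P) -> nat) : rvert P m -> Type :=
| RVertex v : rvert_spec (inl v : rvert P m)
| RPos u i of i <= m u : rvert_spec (rpos m u i).

Lemma rvertP P m (x : rvert P m) : rvert_spec x.
Proof.
case: x => [v|[u i]]; first exact: RVertex.
have -> : inr (existT _ u i) = rpos m u i by rewrite /rpos inord_val.
by apply: RPos; rewrite -ltnS.
Qed.

Definition rfold (P : pathograph) (m : 'I_(pg_nU P) -> nat) (Z : Type)
    (fv : 'I_(pg_nV P) -> Z) (fu : 'I_(pg_nU P) -> nat -> Z) (x : rvert P m) : Z :=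
  match x with inl v => fv v | inr (existT u i) => fu u i end.

Lemma rfold_pos P m Z fv fu u i : i <= m u ->
  @rfold P m Z fv fu (rpos m u i) = fu u i.
Proof. by move=> lei; rewrite /= inordK. Qed.

Lemma rpos_inj P (m : 'I_(pg_nU P) -> nat) u u' i j :
  i <= m u -> j <= m u' -> rpos m u i = rpos m u' j -> u = u' /\ i = j.
Proof.
move=> lei lej eqx.
have := f_equal (rfold (fun=> None) (fun u i => Some (u, i))) eqx.
by rewrite !rfold_pos // => -[-> ->].
Qed.

Lemma base_vpos P (m : 'I_(pg_nU P) -> nat) v u i : i <= m u ->
  base_adj P m (inl v) (rpos m u i) =
  (v == end1 P u :> nat) && (i == 0) || (v == end2 P u :> nat) && (i == m u).
Proof. by move=> lei; rewrite /= inordK. Qed.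

Lemma base_pospos P (m : 'I_(pg_nU P) -> nat) u u' i j : i <= m u -> j <= m u' ->
  base_adj P m (rpos m u i) (rpos m u' j) = (u == u') && ((i.+1 == j) || (j.+1 == i)).
Proof. by move=> lei lej; rewrite /= !inordK. Qed.

Lemma base_adj_sym P m x y : base_adj P m x y = base_adj P m y x.
Proof.
case: x y => [a|[u i]] [b|[u' j]] //=; first by rewrite /is_edge orbC.
by rewrite eq_sym orbC.
Qed.

Section Layout.

Variables (T : finType) (e : rel T) (Q : pathograph).
Local Notation nV := (pg_nV Q).
Local Notation nU := (pg_nU Q).

(** [c p] and [d p] stand for the first and last internal vertex of [p], equal when there is only
    one; this is [base_adj] between a vertex and an urpath, seen in the host graph. *)
Definition end_at (c d : 'I_nU -> T) (a : 'I_nV) (p : 'I_nU) (x : T) :=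
  (a == end1 Q p :> nat) && (x == c p) || (a == end2 Q p :> nat) && (x == d p).

Definition colored_nbrs (col : T -> option ('I_nV + 'I_nU)) p x :=
  [set y | e x y && (col y == Some (inr p))].

(* Containment of [Q] without path lengths: [col] tells which vertex or urpath of
   [Q] a vertex of the graph realizes, and connectedness together with the degree
   bound forces every urpath class to induce a path from [c p] to [d p]. *)
Record layout (g : 'I_nV -> T) (col : T -> option ('I_nV + 'I_nU)) (c d : 'I_nU -> T) :
    Prop := Layout {
  lay_g : forall a, col (g a) = Some (inl a);
  lay_g_uniq : forall x a, col x = Some (inl a) -> x = g a;
  lay_c : forall p, col (c p) = Some (inr p);
  lay_d : forall p, col (d p) = Some (inr p);
  lay_edge : forall a b, e (g a) (g b) = is_edge Q a b;
  lay_end : forall a p x, end_at c d a p x -> e (g a) x;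
  lay_nospoke : forall a p x, col x = Some (inr p) -> e (g a) x ->
     end_at c d a p x || is_spoke Q a p;
  lay_spoke : forall (a : 'I_nV) (p : 'I_nU), is_spoke Q a p ->
     exists x, [/\ col x = Some (inr p), e (g a) x & ~~ end_at c d a p x];
  lay_norung : forall p q x y, p != q -> col x = Some (inr p) -> col y = Some (inr q) ->
     e x y -> is_rung Q p q;
  lay_rung : forall p q : 'I_nU, is_rung Q p q ->
     exists x y, [/\ col x = Some (inr p), col y = Some (inr q) & e x y];
  lay_deg : forall p x, col x = Some (inr p) ->
     #|colored_nbrs col p x| + (x == c p) + (x == d p) <= 2;
  lay_conn : forall p x, col x = Some (inr p) ->
     connect [rel x y | e x y && (col y == Some (inr p))] (c p) x }.

Lemma wf_norung_refl u : wf_pg Q -> is_rung Q u u = false.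
Proof.
case/and5P=> _ _ /allP hR _ _; rewrite /is_rung orbb; apply/negP=> /hR /=.
by rewrite eqxx !andbF.
Qed.

(** Colours are read off the embedding. Each end of a path lacks one neighbour and is credited one
    in exchange, so the count is exactly two. [color_step] needs this equality, whereas the
    transported layout only has to satisfy the inequality. *)
Lemma contains_layout : wf_pg Q -> contains T e Q ->
  exists g col c d, layout g col c d /\
    forall p x, col x = Some (inr p) ->
      #|colored_nbrs col p x| + (x == c p) + (x == d p) = 2.
Proof.
move=> wfQ [m [r [[[rsym rirr] rbase rextra rspoke rrung] [f [finj ef]]]]].
pose kind (z : rvert Q m) : 'I_nV + 'I_nU := rfold inl (fun u _ => inr u) z.
pose col x := omap kind [pick z | f z == x].
have colf z : col (f z) = Some (kind z).
  by rewrite /col; case: pickP => [z' /eqP/finj->|/(_ z)] //; rewrite eqxx.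
have colP x k : col x = Some k -> exists2 z, x = f z & kind z = k.
  by rewrite /col; case: pickP => //= z /eqP<- [<-]; exists z.
have colV x a : col x = Some (inl a) -> x = f (inl a).
  by case/colP=> z ->; case: (rvertP z) => //= v [->].
have colU x p : col x = Some (inr p) -> exists2 i, i <= m p & x = f (rpos m p i).
  case/colP=> z ->; case: (rvertP z) => [//|u i lei]; rewrite /kind rfold_pos // => -[<-].
  by exists i.
pose g a := f (inl a); pose c p := f (rpos m p 0); pose d p := f (rpos m p (m p)).
have posE p i j : i <= m p -> j <= m p -> (f (rpos m p i) == f (rpos m p j)) = (i == j).
  move=> lei lej; apply/eqP/eqP=> [/finj /rpos_inj[] //|->] //.
have endE a p i : i <= m p ->
    end_at c d a p (f (rpos m p i)) = base_adj Q m (inl a) (rpos m p i).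
  by move=> lei; rewrite base_vpos // /end_at !posE.
have rpos_adj p i j : i <= m p -> j <= m p ->
    r (rpos m p i) (rpos m p j) = (i.+1 == j) || (j.+1 == i).
  move=> lei lej; apply/idP/idP=> [/rextra|].
    by rewrite base_pospos //= eqxx wf_norung_refl // orbF.
  by move=> adj; apply: rbase; rewrite base_pospos // eqxx.
have deg2 p x : col x = Some (inr p) ->
    #|colored_nbrs col p x| + (x == c p) + (x == d p) = 2.
  case/colU=> i lei ->; rewrite !posE //.
  have -> : colored_nbrs col p (f (rpos m p i)) =
      (if i < m p then [set f (rpos m p i.+1)] else set0) :|:
      (if 0 < i then [set f (rpos m p i.-1)] else set0).
    apply/setP=> y; rewrite !inE; apply/andP/orP.
      case=> adj /eqP/colU[j lej ey]; move: adj; rewrite ey ef rpos_adj //.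
      case/orP=> /eqP eij.
        by left; rewrite eij lej inE.
      by right; rewrite -eij /= inE.
    have nb j : j <= m p -> (i.+1 == j) || (j.+1 == i) ->
        e (f (rpos m p i)) (f (rpos m p j)) /\ col (f (rpos m p j)) == Some (inr p).
      by move=> lej adj; rewrite ef rpos_adj // colf /kind rfold_pos.
    by case; case: ifP => lti; rewrite ?inE // => /eqP->; apply: nb => //; lia.
  rewrite cardsU; case: (ltngtP i (m p)) lei => // [ltim _|-> _].
    case: i ltim => [|i] ltim; first by rewrite setI0 cards1 cards0.
    rewrite /= !cards1 [_ :&: _](_ : _ = set0) ?cards0 //.
    by apply/setP=> y; rewrite !inE; apply/negP=> /andP[/eqP->]; rewrite posE; lia.
  by case: (m p) => [|k]; rewrite set0I ?cards0 ?cards1.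
exists g, col, c, d; split=> //; split.
- by move=> a; rewrite colf.
- exact: colV.
- by move=> p; rewrite colf.
- by move=> p; rewrite colf.
- move=> a b; rewrite ef; apply/idP/idP=> [/rextra|ab]; first by rewrite /= orbF.
  exact: rbase.
- move=> a p x ax; have [i lei ex] : exists2 i, i <= m p & x = f (rpos m p i).
    by case/orP: (ax) => /andP[_ /eqP->]; [exists 0 | exists (m p)].
  by move: ax; rewrite ex endE // ef; apply: rbase.
- by move=> a p x /colU[i lei ->]; rewrite ef endE // => /rextra.
- move=> a p /rspoke[i]; rewrite -[i]inord_val => /andP[h1 h2].
  have lei : i <= m p by rewrite -ltnS.
  by exists (f (rpos m p i)); rewrite colf endE // ef; split.
- move=> p q x y npq /colU[i lei ->] /colU[j lej ->]; rewrite ef => /rextra.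
  by rewrite base_pospos // (negPf npq).
- move=> p q /rrung[i [j]]; rewrite -[i]inord_val -[j]inord_val => rij.
  by exists (f (rpos m p i)), (f (rpos m q j)); rewrite !colf ef; split.
- by move=> p x /deg2->.
move=> p x /colU[i lei ->]; elim: i lei => [|i IH] lei; first exact: connect0.
apply: connect_trans (IH (ltnW lei)) (connect1 _).
by apply/andP; split; [rewrite ef rpos_adj ?eqxx // ltnW | rewrite colf /kind rfold_pos].
Qed.

(** A simple path from [c] to [d] inside [X] uses up the whole degree allowance of its vertices,
    each end being charged one. Hence no edge inside [X] leaves the path or is a chord of it, and
    connectedness makes it all of [X]. *)
Lemma induced_path (X : pred T) (c d : T) :
    symmetric e -> X c -> X d ->
    (forall x, X x -> #|[set y | e x y && X y]| + (x == c) + (x == d) <= 2) ->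
    (forall x, X x -> connect [rel x y | e x y && X y] c x) ->
  exists s, [/\ uniq (c :: s), last c s = d, (c :: s) =i X &
    forall i j, i <= size s -> j <= size s ->
      e (nth c (c :: s) i) (nth c (c :: s) j) = (i.+1 == j) || (j.+1 == i)].
Proof.
move=> e_sym Xc Xd deg conn.
have leq_deg (x : T) (l : seq T) : uniq l -> {subset l <= [pred y | e x y && X y]} ->
    size l <= #|[set y | e x y && X y]|.
  move=> ul sub; rewrite cardE; apply: uniq_leq_size => // y /sub.
  by rewrite mem_enum !inE.
have /connectP[q] := conn d Xd; case/shortenP=> s pth us _ ed {q}.
pose n i := nth c (c :: s) i.
have adj i : i < size s -> e (n i) (n i.+1) && X (n i.+1) by move/(pathP c pth).
have Xn i : i <= size s -> X (n i) by case: i => [|i] // /adj /andP[].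
have n_eq i j : i <= size s -> j <= size s -> (n i == n j) = (i == j).
  by move=> lei lej; rewrite /n nth_uniq.
have nd : n (size s) = d by rewrite ed (last_nth c).
have nbr i y : i <= size s -> X y -> e (n i) y ->
    (i < size s) && (y == n i.+1) || (0 < i) && (y == n i.-1).
  move=> lei Xy eiy; apply/negPn/negP; rewrite negb_or !negb_and => /andP[h1 h2].
  have degi := deg _ (Xn _ lei).
  pose l := y :: (if i < size s then [:: n i.+1] else [::]) ++
                 (if 0 < i then [:: n i.-1] else [::]).
  have := @leq_deg (n i) l; move: degi.
  rewrite -nd -[c]/(n 0) !n_eq //.
  have subl : {subset l <= [pred z | e (n i) z && X z]}.
    move=> z; rewrite /l in_cons mem_cat; case/or3P.
    - by move/eqP->; rewrite inE eiy.
    - by case: ifP => // lti; rewrite inE => /eqP->; apply: adj.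
    case: i {eiy h1 h2 l} lei => // i lei; rewrite inE => /eqP->.
    by rewrite inE /= Xn ?(ltnW lei) // e_sym; case/andP: (adj _ lei) => ->.
  have ul : uniq l.
    rewrite /l /= mem_cat negb_or; case: ltnP h1 => lti h1; case: ltnP h2 => i0 h2;
      rewrite /= ?inE ?negb_or ?andbT ?h1 ?h2 ?n_eq //; try lia.
  move=> degi /(_ ul subl); move: degi; rewrite /l /= size_cat.
  by case: (ltngtP i (size s)) lei => // lti _; case: (ltngtP i 0) => // i0 /=; lia.
have clos q x : x \in c :: s -> path [rel x y | e x y && X y] x q -> last x q \in c :: s.
  elim: q x => //= y q IH x xs /andP[/andP[exy Xy]]; apply: IH.
  move: (xs); rewrite -index_mem /= ltnS => lti.
  have ex : n (index x (c :: s)) = x by rewrite /n nth_index.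
  have := nbr _ _ lti Xy; rewrite ex => /(_ exy).
  by case/orP=> /andP[h /eqP->]; rewrite /n mem_nth //= ltnS //; lia.
exists s; split=> //.
  move=> x; apply/idP/idP.
    by move=> xs; rewrite -(nth_index c xs); apply: Xn; move: xs; rewrite -index_mem.
  by move=> Xx; have /connectP[q pq ->] := conn x Xx; apply: clos pq; rewrite mem_head.
move=> i j lei lej; apply/idP/idP=> [eij|].
  have := nbr i _ lei (Xn _ lej) eij; case/orP=> /andP[h].
    by rewrite n_eq // => /eqP->; rewrite eqxx.
  rewrite n_eq ?(leq_trans (leq_pred i) lei) // => /eqP->.
  by rewrite prednK // eqxx orbT.
case/orP=> /eqP eij; first by rewrite -eij in lej *; case/andP: (adj _ lej).
by rewrite -eij e_sym in lei *; case/andP: (adj _ lei).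
Qed.

(** Path lengths come from [induced_path] on each colour class. The relation is [e] pulled back
    along [f], so the embedding is induced by construction and the layout clauses turn into those of
    [is_realization]. *)
Lemma layout_contains g col c d : symmetric e -> irreflexive e -> layout g col c d ->
  contains T e Q.
Proof.
move=> e_sym eirr sh.
have /fin_all_exists[s sP] (p : 'I_nU) : exists s, [/\ uniq (c p :: s), last (c p) s = d p,
    (c p :: s) =i [pred x | col x == Some (inr p)] &
    forall i j, i <= size s -> j <= size s ->
      e (nth (c p) (c p :: s) i) (nth (c p) (c p :: s) j) = (i.+1 == j) || (j.+1 == i)].
  have [||x Xx|x /eqP Xx|s [us ls sX sadj]] :=
      @induced_path [pred x | col x == Some (inr p)] (c p) (d p) e_sym.
  - by rewrite /= (lay_c sh).
  - by rewrite /= (lay_d sh).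
  - by apply: (lay_deg sh); apply/eqP.
  - exact: (lay_conn sh).
  by exists s.
pose n p i := nth (c p) (c p :: s p) i.
(* The path [c p :: s p] has one vertex more than [s p], in line with the [m u + 1] internal
   vertices of an urpath. *)
pose m p := size (s p).
have n_col p i : i <= m p -> col (n p i) = Some (inr p).
  move=> lei; case: (sP p) => _ _ /(_ (n p i)); rewrite mem_nth // => /esym.
  by rewrite inE => /eqP.
have n_inj p i j : i <= m p -> j <= m p -> (n p i == n p j) = (i == j).
  by move=> lei lej; case: (sP p) => us _ _ _; rewrite /n nth_uniq.
have n_ex p x : col x = Some (inr p) -> exists2 i, i <= m p & x = n p i.
  move=> cx; have xs : x \in c p :: s p by case: (sP p) => _ _ -> _; rewrite inE cx.
  exists (index x (c p :: s p)); last by rewrite /n nth_index.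
  by move: xs; rewrite -index_mem.
have n_d p : n p (m p) = d p by case: (sP p) => _ <- _ _; rewrite (last_nth (c p)).
have n_adj p i j : i <= m p -> j <= m p -> e (n p i) (n p j) = (i.+1 == j) || (j.+1 == i).
  by case: (sP p) => _ _ _; apply.
pose f : rvert Q m -> T := rfold g n.
have f_pos p i : i <= m p -> f (rpos m p i) = n p i by move=> lei; rewrite /f rfold_pos.
have endE a p i : i <= m p -> end_at c d a p (n p i) = base_adj Q m (inl a) (rpos m p i).
  by move=> lei; rewrite base_vpos // /end_at -n_d -[c p]/(n p 0) !n_inj.
exists m, (fun x y => e (f x) (f y)); split; last first.
  exists f; split=> // x y; case: (rvertP x) => [v|u i lei]; case: (rvertP y) => [v'|u' j lej].
  - by move/(f_equal col); rewrite !(lay_g sh) => -[->].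
  - by rewrite f_pos // => /(f_equal col); rewrite (lay_g sh) n_col.
  - by rewrite f_pos // => /(f_equal col); rewrite (lay_g sh) n_col.
  rewrite !f_pos // => eq; have := f_equal col eq; rewrite !n_col // => -[eu].
  by move: lei eq; rewrite eu => lei /eqP; rewrite n_inj // => /eqP->.
split.
- by split=> [x y|x]; rewrite ?eirr // e_sym.
- have wl v u i : i <= m u -> base_adj Q m (inl v) (rpos m u i) -> e (g v) (n u i).
    by move=> lei; rewrite -endE //; exact: (lay_end sh).
  move=> x y; case: (rvertP x) => [v|u i lei]; case: (rvertP y) => [v'|u' j lej].
  - by rewrite /= (lay_edge sh).
  - by rewrite f_pos //; apply: wl.
  - by rewrite f_pos // base_adj_sym e_sym; apply: wl.
  by rewrite !f_pos // base_pospos // => /andP[/eqP eu]; subst u'; rewrite n_adj.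
- have wl v u i : i <= m u -> e (g v) (n u i) ->
      base_adj Q m (inl v) (rpos m u i) || is_spoke Q v u.
    by move=> lei; rewrite -endE //; apply: (lay_nospoke sh); rewrite n_col.
  move=> x y; case: (rvertP x) => [v|u i lei]; case: (rvertP y) => [v'|u' j lej].
  - by rewrite /= (lay_edge sh) => ->.
  - by rewrite f_pos // => /(wl _ _ _ lej).
  - by rewrite f_pos // e_sym base_adj_sym => /(wl _ _ _ lei).
  rewrite !f_pos // base_pospos //; have [eu|ne] := eqVneq u u'.
    by subst u'; rewrite n_adj // => ->.
  by move=> h; rewrite /= (lay_norung sh ne _ _ h) ?n_col.
- move=> v u /(lay_spoke sh)[x [/n_ex[i lei ->] h1 h2]].
  by exists (inord i); have := f_pos u i lei; rewrite /rpos => ->; rewrite h1 -[X in base_adj _ _ _ X]/(rpos m u i) -endE.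
move=> u u' /(lay_rung sh)[x [y [/n_ex[i lei ->] /n_ex[j lej ->] h]]].
by exists (inord i), (inord j); have := f_pos u i lei; have := f_pos u' j lej; rewrite /rpos => -> ->.
Qed.

End Layout.

(** * Transfer between graphs of words *)

(** [P] is not assumed monotone in the list, so each index keeps its own list inside [L]. *)
Lemma cover_choice (I : finType) (T : eqType) (k : nat) (P : I -> seq T -> Prop) :
    (forall i, exists l, size l <= k /\ P i l) ->
  exists L : seq T, size L <= k * #|I| /\ forall i, exists l, P i l /\ {subset l <= L}.
Proof.
move/fin_all_exists=> [l lP]; exists (flatten [seq l i | i <- enum I]); split.
  rewrite size_flatten cardE mulnC; elim: (enum I) => //= i s IH.
  by rewrite mulSn leq_add //; case: (lP i).
move=> i; exists (l i); split; first by case: (lP i).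
by move=> x xl; apply/flattenP; exists (l i) => //; apply: map_f; rewrite mem_enum.
Qed.

(* The marked positions: images of vertices of [Q], both ends of each urpath, the at most
   two neighbours that a vertex of [H] has on the urpath passing through it, and witnesses
   for the spokes and rungs. *)
Definition mark_bound (n k l : nat) := k + 2 * l + 2 * n + k * l + 2 * (l * l).

Section Marks.

Variables (T : finType) (e : rel T) (Q : pathograph) (n : nat) (h : 'I_n -> T).
Variables (g : 'I_(pg_nV Q) -> T) (col : T -> option ('I_(pg_nV Q) + 'I_(pg_nU Q))).
Variables (c d : 'I_(pg_nU Q) -> T).

Record marking (S : seq T) : Prop := Marking {
  mk_g : forall a, g a \in S;
  mk_c : forall p, c p \in S;
  mk_d : forall p, d p \in S;
  mk_nbr : forall v p y, col (h v) = Some (inr p) -> col y = Some (inr p) ->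
     e (h v) y -> y \in S;
  mk_spoke : forall (a : 'I_(pg_nV Q)) (p : 'I_(pg_nU Q)), is_spoke Q a p ->
     exists2 x, x \in S & [/\ col x = Some (inr p), e (g a) x & ~~ end_at c d a p x];
  mk_rung : forall p q : 'I_(pg_nU Q), is_rung Q p q ->
     exists x y, [/\ x \in S, y \in S, col x = Some (inr p), col y = Some (inr q) & e x y] }.

Lemma marking_exists : layout e g col c d ->
  exists S, size S <= mark_bound n (pg_nV Q) (pg_nU Q) /\ marking S.
Proof.
move=> sh.
have [|L1 [s1 P1]] := @cover_choice 'I_(pg_nV Q) T 1 (fun a l => g a \in l).
  by move=> a; exists [:: g a]; rewrite mem_head.
have [|L2 [s2 P2]] :=
    @cover_choice 'I_(pg_nU Q) T 2 (fun p l => (c p \in l) && (d p \in l)).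
  by move=> p; exists [:: c p; d p]; rewrite !inE !eqxx orbT.
have [|L3 [s3 P3]] := @cover_choice 'I_n T 2 (fun v l => forall p y,
    col (h v) = Some (inr p) -> col y = Some (inr p) -> e (h v) y -> y \in l).
  move=> v; case E: (col (h v)) => [[a|p]|]; try by exists [::].
  exists (enum (colored_nbrs e col p (h v))); split.
    by rewrite -cardE; have := lay_deg sh E; lia.
  by move=> p' y [<-] cy ey; rewrite mem_enum inE ey cy eqxx.
have [|L4 [s4 P4]] := @cover_choice ('I_(pg_nV Q) * 'I_(pg_nU Q))%type T 1
    (fun ap l => is_spoke Q ap.1 ap.2 -> exists2 x, x \in l &
       [/\ col x = Some (inr ap.2), e (g ap.1) x & ~~ end_at c d ap.1 ap.2 x]).
  move=> [a p] /=; case E: (is_spoke Q a p); last by exists [::].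
  by have [x xP] := lay_spoke sh E; exists [:: x]; split=> // _; exists x; rewrite ?mem_head.
have [|L5 [s5 P5]] := @cover_choice ('I_(pg_nU Q) * 'I_(pg_nU Q))%type T 2
    (fun pq l => is_rung Q pq.1 pq.2 -> exists x y,
       [/\ x \in l, y \in l, col x = Some (inr pq.1), col y = Some (inr pq.2) & e x y]).
  move=> [p q] /=; case E: (is_rung Q p q); last by exists [::].
  have [x [y [hx hy hxy]]] := lay_rung sh E; exists [:: x; y]; split=> // _.
  by exists x, y; rewrite !inE !eqxx orbT.
(* The five lists account, in order, for the five summands of [mark_bound]. *)
exists (L1 ++ L2 ++ L3 ++ L4 ++ L5); split.
  move: s1 s2 s3 s4 s5; rewrite !card_prod !card_ord !mul1n => s1 s2 s3 s4 s5.
  by rewrite !size_cat !addnA; apply: leq_add s5; apply: leq_add s4; apply: leq_add s3; apply: leq_add s2.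
split.
- by move=> a; have [l [hl sub]] := P1 a; rewrite mem_cat (sub _ hl).
- by move=> p; have [l [/andP[hl _] sub]] := P2 p; rewrite !mem_cat (sub _ hl) !orbT.
- by move=> p; have [l [/andP[_ hl] sub]] := P2 p; rewrite !mem_cat (sub _ hl) !orbT.
- move=> v p y h1 h2 h3; have [l [hl sub]] := P3 v.
  by rewrite !mem_cat (sub _ (hl _ _ h1 h2 h3)) !orbT.
- move=> a p sp; have [l [hl sub]] := P4 (a, p); have [x xl xP] := hl sp.
  by exists x; rewrite // !mem_cat (sub _ xl) !orbT.
move=> p q rg; have [l [hl sub]] := P5 (p, q); have [x [y [xl yl h1 h2 h3]]] := hl rg.
by exists x, y; rewrite !mem_cat (sub _ xl) (sub _ yl) !orbT.
Qed.

End Marks.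

Section WordGraph.

Variable H : pathograph.
Local Notation letter := ({set 'I_(pg_nV H)} * (bool * bool))%type.
Implicit Types (m : 'I_(pg_nU H) -> nat) (W : 'I_(pg_nU H) -> seq letter).

Definition row W u i : {set 'I_(pg_nV H)} := (nth (set0, (false, false)) (W u) i).1.

(** A letter lists all neighbours among the vertices of [H], endpoints of the urpath included;
    distinct words are not adjacent, as in a realization without rungs. *)
Definition wrel m W (x y : rvert H m) : bool :=
  match x, y with
  | inl a, inl b => is_edge H a b
  | inl v, inr (existT u i) | inr (existT u i), inl v => v \in row W u i
  | inr (existT u i), inr (existT u' j) =>
      (u == u') && ((i.+1 == j :> nat) || (j.+1 == i :> nat))
  end.

Lemma wrel_vpos m W v u i : i <= m u ->
  wrel W (inl v) (rpos m u i) = (v \in row W u i).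
Proof. by move=> lei; rewrite /= inordK. Qed.

Lemma wrel_pospos m W u u' i j : i <= m u -> j <= m u' ->
  wrel W (rpos m u i) (rpos m u' j) = (u == u') && ((i.+1 == j) || (j.+1 == i)).
Proof. by move=> lei lej; rewrite /= !inordK. Qed.

Lemma wrel_sym m W : symmetric (@wrel m W).
Proof.
case=> [a|[u i]] [b|[u' j]] //=; first by rewrite /is_edge orbC.
by rewrite eq_sym orbC.
Qed.

Lemma wrel_irr m W : wf_pg H -> irreflexive (@wrel m W).
Proof.
case/andP=> /allP hE _ [a|[u i]] /=; last by rewrite eqxx; lia.
by apply/negP; rewrite /is_edge orbb => /hE; rewrite eqxx !andbF.
Qed.

(** Names for vertices of [H], marks and gaps that make sense in two graphs at once; only the name
    of a gap can denote several vertices. *)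
Definition block m (M : 'I_(pg_nU H) -> nat -> bool) (x : rvert H m) :
  'I_(pg_nV H) + 'I_(pg_nU H) * nat * bool :=
  rfold inl (fun u i => inr (u, rank (M u) i, M u i)) x.

Definition single (b : 'I_(pg_nV H) + 'I_(pg_nU H) * nat * bool) : bool :=
  if b is inr (_, _, marked) then marked else true.

Lemma block_pos m M u i : i <= m u ->
  block M (rpos m u i) = inr (u, rank (M u) i, M u i).
Proof. by move=> lei; rewrite /block rfold_pos. Qed.

Lemma block_inj m M (x y : rvert H m) : block M x = block M y -> single (block M x) -> x = y.
Proof.
case: (rvertP x) => [v|u i lei]; case: (rvertP y) => [v'|u' j lej]; rewrite ?block_pos //.
  by case=> ->.
case=> eu er eM /= Mi; subst u'; congr rpos; apply: rank_mark_inj er => //.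
by rewrite -eM.
Qed.

Section Aligned.

Variables (m m' : 'I_(pg_nU H) -> nat) (W W' : 'I_(pg_nU H) -> seq letter).
Variables (M M' : 'I_(pg_nU H) -> nat -> bool).
Hypotheses (szW : forall u, size (W u) = (m u).+1) (szW' : forall u, size (W' u) = (m' u).+1).
Hypothesis al : forall u, aligned (M u) (W u) (M' u) (W' u).
Hypothesis al' : forall u, aligned (M' u) (W' u) (M u) (W u).

Lemma block_match (x : rvert H m) : exists x' : rvert H m',
  block M' x' = block M x /\ forall v, wrel W' (inl v) x' = wrel W (inl v) x.
Proof.
case: (rvertP x) => [v|u i lei]; first by exists (inl v).
have : onth (W u) i by rewrite onthTE szW ltnS.
case E: (onth (W u) i) => [a|] // _; have [j [Ej rj Mj]] := al E.
have lej : j <= m' u by rewrite -ltnS -szW' -onthTE Ej.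
exists (rpos m' u j); rewrite !block_pos // rj Mj; split=> // v.
by rewrite !wrel_vpos // /row (onth_nth _ _ _ _ E) (onth_nth _ _ _ _ Ej).
Qed.

(** The ends of the edge found lie in the right blocks but need not match [x] and [y] themselves.
    Edges inside a gap are excluded because the corresponding gap may be a single position. *)
Lemma block_adj (x y : rvert H m) : wrel W x y -> block M x <> block M y ->
  exists x' y' : rvert H m', [/\ block M' x' = block M x, block M' y' = block M y & wrel W' x' y'].
Proof.
case: (rvertP x) => [v|u i lei]; case: (rvertP y) => [v'|u' j lej].
- by move=> h _; exists (inl v), (inl v').
- by have [y' [ey ay]] := block_match (rpos m u' j) => h _; exists (inl v), y'; rewrite ay.
- have [x' [ex ax]] := block_match (rpos m u i).
  by rewrite wrel_sym => h _; exists x', (inl v'); rewrite wrel_sym ax.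
have succ k : k < m u -> block M (rpos m u k) <> block M (rpos m u k.+1) ->
    exists k', [/\ k' < m' u, block M' (rpos m' u k') = block M (rpos m u k) &
                   block M' (rpos m' u k'.+1) = block M (rpos m u k.+1)].
  move=> ltk ne; have ltk1 : k.+1 < size (W u) by rewrite szW.
  have [|k' [ltk' e1 e2]] := aligned_succ (@al u) (@al' u) ltk1.
    by move=> [e1 e2]; apply: ne; rewrite !block_pos ?(ltnW ltk) //; congr (inr (u, _, _)).
  rewrite szW' ltnS in ltk'; exists k'; split=> //; rewrite !block_pos ?(ltnW ltk) ?(ltnW ltk') //.
    by case: e1 => e e'; congr (inr (u, _, _)).
  by case: e2 => e e'; congr (inr (u, _, _)).
rewrite wrel_pospos // => /andP[/eqP eu /orP[]/eqP eij] ne; subst u'.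
  subst j; have [k [ltk e1 e2]] := succ _ lej ne.
  by exists (rpos m' u k), (rpos m' u k.+1); rewrite wrel_pospos ?eqxx ?(ltnW ltk).
subst i; have [k [ltk e1 e2]] := succ _ lei (fun e => ne (esym e)).
by exists (rpos m' u k.+1), (rpos m' u k); rewrite wrel_pospos ?eqxx ?orbT ?(ltnW ltk).
Qed.

End Aligned.


(** * Transporting a layout from the primed graph to an aligned one *)

Section Transfer.

Variables (m m' : 'I_(pg_nU H) -> nat) (W W' : 'I_(pg_nU H) -> seq letter).
Variables (M M' : 'I_(pg_nU H) -> nat -> bool) (Q : pathograph).
Variables (g' : 'I_(pg_nV Q) -> rvert H m').
Variables (col' : rvert H m' -> option ('I_(pg_nV Q) + 'I_(pg_nU Q))).
Variables (c' d' : 'I_(pg_nU Q) -> rvert H m') (S : seq (rvert H m')).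
Hypothesis wfH : wf_pg H.
Hypotheses (szW : forall u, size (W u) = (m u).+1) (szW' : forall u, size (W' u) = (m' u).+1).
Hypothesis al : forall u, aligned (M u) (W u) (M' u) (W' u).
Hypothesis al' : forall u, aligned (M' u) (W' u) (M u) (W u).
Hypothesis lay' : layout (@wrel m' W') g' col' c' d'.
Hypothesis deg2 : forall p x, col' x = Some (inr p) ->
  #|colored_nbrs (@wrel m' W') col' p x| + (x == c' p) + (x == d' p) = 2.
Hypothesis mkS : marking (@wrel m' W') (fun v => inl v) g' col' c' d' S.
Hypothesis M'S : forall u i, i <= m' u -> M' u i = (rpos m' u i \in S).

Local Notation e := (@wrel m W).
Local Notation e' := (@wrel m' W').

Lemma single_mark x : x \in S -> single (block M' x).
Proof. by case: (rvertP x) => [v //|u i lei]; rewrite block_pos //= M'S. Qed.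

(* An unmarked vertex on an urpath of [Q] is not an end and its two neighbours there are not
   vertices of [H], hence they are the adjacent positions of the same word. *)
Lemma color_step u i j p : i <= m' u -> j <= m' u -> (i.+1 == j) || (j.+1 == i) ->
    M' u i = false -> col' (rpos m' u i) = Some (inr p) -> col' (rpos m' u j) = Some (inr p).
Proof.
move=> lei lej adj nM cx; apply/eqP/negPn/negP=> ncy.
have xS : rpos m' u i \notin S by rewrite -M'S // nM.
have := deg2 cx.
have -> : (rpos m' u i == c' p) = false.
  by apply/negP=> /eqP ex; rewrite ex (mk_c mkS) in xS.
have -> : (rpos m' u i == d' p) = false.
  by apply/negP=> /eqP ex; rewrite ex (mk_d mkS) in xS.
(* If [j] is not coloured [p], only the other adjacent position can be a coloured neighbour, against
   the total of two. *)
suff sub : colored_nbrs e' col' p (rpos m' u i) \subset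
           [set rpos m' u (if i.+1 == j then i.-1 else i.+1)].
  by have := subset_leq_card sub; rewrite cards1; lia.
apply/subsetP=> z; rewrite !inE => /andP[exz cz]; move: exz.
case: (rvertP z) cz => [v|u' k lek] cz.
  by rewrite wrel_sym => exz; rewrite (mk_nbr mkS (eqP cz) cx exz) in xS.
rewrite wrel_pospos // => /andP[/eqP eu eik]; subst u'.
have nkj : k != j by apply/eqP=> ekj; rewrite ekj (negPf ncy) in cz.
by apply/eqP; congr rpos; move: adj eik nkj; case: ifP; lia.
Qed.

(** Vertices of [Q] sit on marks, so an unmarked position is uncoloured or on an urpath;
    [color_step] spreads an urpath colour both ways, so it cannot stop between the two positions. *)
Lemma color_succ u i : i < m' u -> M' u i = false -> M' u i.+1 = false ->
  col' (rpos m' u i) = col' (rpos m' u i.+1).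
Proof.
move=> lti nM nM1; have lei := ltnW lti.
have nV k a : k <= m' u -> M' u k = false -> col' (rpos m' u k) <> Some (inl a).
  by move=> lek nMk /(lay_g_uniq lay') ex; rewrite M'S // ex (mk_g mkS) in nMk.
case E: (col' (rpos m' u i)) => [[a|p]|]; first by case: (nV _ _ lei nM E).
  by rewrite (color_step (j := i.+1) _ _ _ nM E) // eqxx.
case E1: (col' (rpos m' u i.+1)) => [[a|p]|] //; first by case: (nV _ _ lti nM1 E1).
by rewrite (color_step (j := i) _ _ _ nM1 E1) ?eqxx ?orbT // in E.
Qed.

Lemma color_block x y : block M' x = block M' y -> col' x = col' y.
Proof.
move=> eb; case sb: (single (block M' x)); first by rewrite (block_inj eb).
move: eb sb; case: (rvertP x) => [v|u i lei]; case: (rvertP y) => [v'|u' j lej];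
  rewrite ?block_pos // => -[eu er eM] /= nMi; subst u'.
wlog le_ij : i j lei lej er eM nMi / i <= j.
  move=> Hw; case/orP: (leq_total i j) => le; first exact: Hw.
  by symmetry; apply: Hw; rewrite // -?eM // er.
have bet k : i <= k <= j -> M' u k = false.
  by move=> ikj; have [] := rank_between er (etrans (esym eM) nMi) ikj.
have -> : j = i + (j - i) by lia.
have : i + (j - i) <= j by lia.
elim: (j - i) => [|k IH] lek; first by rewrite addn0.
rewrite IH ?addnS; last by lia.
by apply: color_succ; rewrite ?bet //; lia.
Qed.

Lemma block_vertex m0 M0 (x : rvert H m0) v : block M0 x = inl v -> x = inl v.
Proof. by case: (rvertP x) => [v' [->]|u i lei] //; rewrite block_pos. Qed.

(** Only a gap could hold two neighbours. The two sides of a marked position differ in rank; for a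
    vertex of [H], the premise on [v] and [t] makes the neighbours singletons. *)
Lemma block_nbr_inj x y z : single (block M x) -> e x y -> e x z ->
    (forall v t, x = inl v -> e x t -> t = y \/ t = z -> single (block M t)) ->
  block M y = block M z -> y = z.
Proof.
move=> sx exy exz sv eb; case sy: (single (block M y)); first exact: block_inj eb sy.
case: (rvertP x) sx exy exz sv => [v|u i lei] sx exy exz sv.
  by rewrite (sv v y) in sy => //; left.
move: eb exy exz sy; case: (rvertP y) => [v'|u1 j lej] //; case: (rvertP z) => [v'|u2 k lek];
  rewrite ?block_pos // => -[eu er eM].
rewrite !wrel_pospos // => /andP[/eqP eu1 aij] /andP[/eqP eu2 aik] _; subst u1 u2.
congr rpos; move: sx; rewrite block_pos //= => Mi.
move: er; case/orP: aij aik => /eqP ej /orP[] /eqP ek; subst; rewrite /= ?Mi; lia.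
Qed.

(** The colouring is pulled back along [tau], which keeps block and letter; [sig] goes the other way
    and is inverse to [tau] on singleton blocks. Witnesses for existential clauses are moved by
    [sig]; universal clauses are checked by moving edges to the primed graph block by block. *)
Lemma layout_transfer : exists g col c d, layout e g col (c : 'I_(pg_nU Q) -> _) d.
Proof.
have e_irr : irreflexive e by apply: wrel_irr.
have e'_irr : irreflexive e' by apply: wrel_irr.
have /fin_all_exists[tau tauP] := block_match szW szW' al.
have /fin_all_exists[sig sigP] (x' : rvert H m') :
    exists x : rvert H m, block M x = block M' x'.
  by have [x [bx _]] := block_match szW' szW al' x'; exists x.
have tauB x : block M' (tau x) = block M x by case: (tauP x).
have tau_sig x' : single (block M' x') -> tau (sig x') = x'.
  by move=> sx; apply: (@block_inj m' M'); rewrite tauB sigP.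
have tau_inj x y : single (block M x) -> tau x = tau y -> x = y.
  by move=> sx exy; apply: (@block_inj m M) => //; rewrite -!tauB exy.
have eq_sig x x' : x' \in S -> (x == sig x') = (tau x == x').
  move=> /single_mark sx; apply/eqP/eqP=> [->|ex]; first exact: tau_sig.
  by apply: tau_inj; [rewrite -tauB ex | rewrite tau_sig].
have sigS x' : x' \in S -> single (block M (sig x')) by rewrite sigP; apply: single_mark.
pose g a := sig (g' a); pose c p := sig (c' p); pose d p := sig (d' p).
pose col x := col' (tau x).
have colS x' : x' \in S -> col (sig x') = col' x' by move=> /single_mark /tau_sig; rewrite /col => ->.
have colB x x' : block M' x' = block M x -> col' x' = col x.
  by rewrite -tauB; apply: color_block.
have lift x y : e x y -> block M x <> block M y -> exists x' y',
    [/\ block M' x' = block M x, block M' y' = block M y & e' x' y'].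
  exact: (block_adj szW szW' al al').
(* Colours are constant on blocks, so an edge between two colours joins two blocks and can be
   moved. *)
have back x y : e x y -> col x <> col y -> exists x' y',
    [/\ block M' x' = block M x, block M' y' = block M y & e' x' y'].
  move=> exy ncol; apply: lift => // eb; apply: ncol.
  by apply: color_block; rewrite !tauB.
have toTau x x' : block M' x' = block M x -> single (block M x) -> x' = tau x.
  by move=> ex sx; apply: (@block_inj m' M'); rewrite ?tauB ex.
have adjS x y : single (block M x) -> single (block M y) -> e x y = e' (tau x) (tau y).
  move=> sx sy; apply/idP/idP=> [exy|].
    have [|x' [y' [bx by_ exy']]] := lift x y exy.
      by move/block_inj=> /(_ sx) exy1; rewrite exy1 e_irr in exy.
    by rewrite -(toTau _ _ bx sx) -(toTau _ _ by_ sy).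
  move=> exy; have [|x1 [y1 [bx by_ exy1]]] := block_adj szW' szW al' al exy.
    rewrite !tauB => /block_inj/(_ sx) e1; rewrite e1 e'_irr in exy; done.
  rewrite !tauB in bx by_.
  by rewrite -(block_inj bx) ?bx // -(block_inj by_) ?by_.
have endE a p x : end_at c d a p x = end_at c' d' a p (tau x).
  by rewrite /end_at !eq_sig ?(mk_c mkS) ?(mk_d mkS).
have end_S a p x' : end_at c' d' a p x' -> x' \in S.
  by case/orP=> /andP[_ /eqP->]; [apply: (mk_c mkS) | apply: (mk_d mkS)].
have tau_g a : tau (g a) = g' a by apply/eqP; rewrite -eq_sig // (mk_g mkS).
have sg a : single (block M (g a)) by apply: sigS; apply: (mk_g mkS).
exists g, col, c, d; split.
- by move=> a; rewrite colS ?(mk_g mkS) // (lay_g lay').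
- move=> x a /(lay_g_uniq lay') ex; apply/eqP; rewrite eq_sig ?ex //.
  exact: (mk_g mkS).
- by move=> p; rewrite colS ?(mk_c mkS) // (lay_c lay').
- by move=> p; rewrite colS ?(mk_d mkS) // (lay_d lay').
- by move=> a b; rewrite adjS // !tau_g (lay_edge lay').
- move=> a p x; rewrite endE => ax; rewrite adjS //.
    by rewrite tau_g; apply: (lay_end lay') ax.
  by rewrite -tauB; apply/single_mark/(end_S _ _ _ ax).
- move=> a p x cx eax; have [|x' [y' [bx by_ exy]]] := back _ _ eax.
    by rewrite cx colS ?(mk_g mkS) // (lay_g lay').
  have cy : col' y' = Some (inr p) by rewrite (colB _ _ by_).
  have ex := toTau _ _ bx (sg a); rewrite ex tau_g in exy.
  case/orP: (lay_nospoke lay' cy exy) => [ay|->]; last by rewrite orbT.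
  rewrite endE -(toTau _ _ by_) ?ay // -by_.
  exact/single_mark/(end_S _ _ _ ay).
- move=> a p /(mk_spoke mkS)[x' x'S [cx ex nend]]; exists (sig x').
  have tx := tau_sig _ (single_mark x'S); split; [by rewrite colS | | by rewrite endE tx].
  by rewrite (adjS _ _ (sg a) (sigS _ x'S)) tau_g tx.
- move=> p q x y npq cx cy exy; have [|x' [y' [bx by_ exy']]] := back _ _ exy.
    by rewrite cx cy => -[epq]; rewrite epq eqxx in npq.
  by apply: (lay_norung lay' npq _ _ exy'); rewrite ?(colB _ _ bx) ?(colB _ _ by_).
- move=> p q /(mk_rung mkS)[x' [y' [xS yS cx cy exy]]]; exists (sig x'), (sig y').
  by rewrite !colS // adjS ?sigS // !tau_sig ?single_mark.
(* At a singleton block, the coloured neighbours of [x] inject into those of [tau x], each going to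
   a neighbour in its own block. *)
- move=> p x cx; case sx: (single (block M x)).
    rewrite !eq_sig ?(mk_c mkS) ?(mk_d mkS) //.
    apply: leq_trans (lay_deg lay' cx); rewrite !leq_add2r.
    have /fin_all_exists[nu nuP] (y : rvert H m) : exists y' : rvert H m',
        y \in colored_nbrs e col p x ->
        y' \in colored_nbrs e' col' p (tau x) /\ block M' y' = block M y.
      case yx: (y \in _); last by exists (tau x).
      move: yx; rewrite inE => /andP[exy cy].
      have [|x' [y' [bx by_ exy']]] := lift _ _ exy.
        by move/block_inj=> /(_ sx) e1; rewrite e1 e_irr in exy.
      exists y' => _; split=> //; rewrite inE -(toTau _ _ bx sx) exy' /=.
      by rewrite (colB _ _ by_).
    have nu_inj : {in colored_nbrs e col p x &, injective nu}.
      move=> y z ys zs eyz; have [_ by_] := nuP y ys; have [_ bz] := nuP z zs.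
      have eb : block M y = block M z by rewrite -by_ -bz eyz.
      move: (ys) (zs); rewrite !inE => /andP[exy cy] /andP[exz cz].
      apply: (block_nbr_inj sx exy exz _ eb) => v t ex _ et.
      have {et} /andP[ext /eqP ct] : e x t && (col t == Some (inr p)).
        by case: et => ->; rewrite ?exy ?exz.
      rewrite -tauB; apply: single_mark; apply: (mk_nbr mkS (v := v) (p := p)) => //.
        by rewrite -cx /col (@block_vertex _ M' (tau x) v) // tauB ex.
      by case: (tauP t) => _ ->; rewrite -ex.
    rewrite -(card_in_imset nu_inj); apply: subset_leq_card.
    by apply/subsetP=> _ /imsetP[y ys ->]; case: (nuP y ys).
  have -> : (x == c p) = false.
    by apply/negP=> /eqP ex; rewrite ex sigS ?(mk_c mkS) in sx.
  have -> : (x == d p) = false.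
    by apply/negP=> /eqP ex; rewrite ex sigS ?(mk_d mkS) in sx.
  (* In a gap, a coloured neighbour in [H] would have forced a mark through [mk_nbr], so only the
     two adjacent positions remain. *)
  rewrite !addn0; case: (rvertP x) cx sx => [//|u i lei] cx sx.
  apply: (@leq_trans #|[set rpos m u i.-1; rpos m u i.+1]|); last by rewrite cards2; case: eqP.
  apply/subset_leq_card/subsetP=> z; rewrite !inE => /andP[exz /eqP cz]; move: exz cz.
  case: (rvertP z) => [v|u' k lek].
    rewrite wrel_sym => exz cz; case/negP: (negbT sx); rewrite -tauB.
    apply: single_mark; apply: (mk_nbr mkS (v := v) (p := p)) => //.
      by rewrite -cz /col (@block_vertex _ M' (tau (inl v)) v) // tauB.
    by case: (tauP (rpos m u i)) => _ ->.
  rewrite wrel_pospos // => /andP[/eqP<- /orP[]/eqP<-] _; first by rewrite eqxx orbT.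
  by rewrite eqxx.
move=> p x cx.
pose rX := [rel x y | e x y && (col y == Some (inr p))].
(* A gap is an interval of one colour, hence connected within its colour class. *)
have in_block y z : block M y = block M z -> col y = Some (inr p) -> connect rX y z.
  move=> eb cy; case sy: (single (block M y)); first by rewrite (block_inj eb).
  move: eb cy sy; case: (rvertP y) => [v|u i lei]; case: (rvertP z) => [v'|u' j lej];
    rewrite ?block_pos // => -[eu er eM] cy /= nMi; subst u'.
  have chain a b : a <= b -> b <= m u -> rank (M u) a = rank (M u) b -> M u b = false ->
      col (rpos m u b) = Some (inr p) ->
      connect rX (rpos m u a) (rpos m u b) /\ connect rX (rpos m u b) (rpos m u a).
    move=> leab leb erab nMb cb.
    have bet k : a <= k <= b -> col (rpos m u k) = Some (inr p).
      move=> akb; rewrite -cb; apply: color_block; rewrite !tauB !block_pos //; last by lia.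
      by have [-> ->] := rank_between erab nMb akb; rewrite nMb.
    suff step k : a + k <= b -> connect rX (rpos m u a) (rpos m u (a + k)) /\
                                connect rX (rpos m u (a + k)) (rpos m u a).
      by have := step (b - a); rewrite subnKC // => /(_ (leqnn b)).
    elim: k => [|k IH] lek; first by rewrite addn0.
    have [|IH1 IH2] := IH; first by lia.
    rewrite addnS in lek *; split.
      apply: connect_trans IH1 (connect1 _); apply/andP; split.
        by rewrite wrel_pospos ?eqxx //; lia.
      by rewrite bet //; lia.
    apply: connect_trans (connect1 _) IH2; apply/andP; split.
      by rewrite wrel_pospos ?eqxx ?orbT //; lia.
    by rewrite bet //; lia.
  case/orP: (leq_total i j) => le.
    have [] // := chain i j le lej er (etrans (esym eM) nMi).
    by rewrite -cy; apply: color_block; rewrite !tauB !block_pos // er eM.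
  by have [] := chain j i le lei (esym er) nMi cy.
(* The invariant speaks of the whole block, because a moved edge may start anywhere in one block and
   end anywhere in the next. *)
have path_lift s : forall x', (forall y, block M y = block M' x' -> connect rX (c p) y) ->
    path [rel x y | e' x y && (col' y == Some (inr p))] x' s ->
    forall y, block M y = block M' (last x' s) -> connect rX (c p) y.
  elim: s => //= y' s IH x' cx' /andP[/andP[exy /eqP cy'] ps]; apply: IH ps => y bY.
  have [eb|ne] := eqVneq (block M' x') (block M' y'); first by apply: cx'; rewrite eb.
  have [|x0 [y0 [bx0 by0 e0]]] := block_adj szW' szW al' al exy; first exact/eqP.
  have cy0 : col y0 = Some (inr p) by rewrite -(colB _ _ (esym by0)).
  apply: connect_trans (cx' _ bx0) _; apply: (@connect_trans _ _ y0).
    by apply: connect1; rewrite /= e0 cy0 /=.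
  by apply: in_block; rewrite // by0.
have /connectP[s ps lx] := lay_conn lay' cx.
apply: (path_lift s (c' p) _ ps); last by rewrite -lx tauB.
move=> y bY; have -> : y = c p; last exact: connect0.
by apply: (@block_inj m M); rewrite bY ?sigP // single_mark // (mk_c mkS).
Qed.

End Transfer.

End WordGraph.

(** * The bound on path lengths *)

Lemma rank_count (M : nat -> bool) n : rank M n = count M (iota 0 n).
Proof.
by elim: n => // n IH; rewrite -[in RHS]addn1 iotaD count_cat -IH /= addn0.
Qed.

Lemma rank_marks (H : pathograph) (m : 'I_(pg_nU H) -> nat) (S : seq (rvert H m)) u :
  rank (fun i => (i <= m u) && (rpos m u i \in S)) (m u).+1 <= size S.
Proof.
rewrite rank_count -size_filter -(size_map (rpos m u)); apply: uniq_leq_size.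
  rewrite map_inj_in_uniq ?filter_uniq ?iota_uniq // => i j.
  by rewrite !mem_filter => /andP[/andP[lei _] _] /andP[/andP[lej _] _] /rpos_inj[].
by move=> x /mapP[i]; rewrite mem_filter => /andP[/andP[_ h] _] ->.
Qed.

(** At most [N] marks fall on each word of [W'], so its profile provides an aligned marking of [W].
    In the application [W'] is the shortened family, so avoiding [Q] passes from long words to short
    ones. *)
Lemma contains_profile (H Q : pathograph) (m m' : 'I_(pg_nU H) -> nat)
    (W W' : 'I_(pg_nU H) -> seq ({set 'I_(pg_nV H)} * (bool * bool))) N :
    wf_pg H -> wf_pg Q -> mark_bound (pg_nV H) (pg_nV Q) (pg_nU Q) <= N ->
    (forall u, size (W u) = (m u).+1) -> (forall u, size (W' u) = (m' u).+1) ->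
    (forall u, profile N (W' u) = profile N (W u)) ->
  contains (rvert H m') (@wrel H m' W') Q -> contains (rvert H m) (@wrel H m W) Q.
Proof.
move=> wfH wfQ leN szW szW' eqp /(contains_layout wfQ)[g' [col' [c' [d' [lay' deg2]]]]].
have [S [szS mkS]] := marking_exists (fun v => inl v) lay'.
pose M' u i := (i <= m' u) && (rpos m' u i \in S).
have /fin_all_exists[M al] (u : 'I_(pg_nU H)) : exists M,
    aligned M (W u) (M' u) (W' u) /\ aligned (M' u) (W' u) M (W u).
  apply: (@profile_aligned _ N); first by rewrite eqp.
  by rewrite szW'; apply: leq_trans (rank_marks S u) (leq_trans szS leN).
have M'S u i : i <= m' u -> M' u i = (rpos m' u i \in S) by rewrite /M' => ->.
have [g [col [c [d lay]]]] := layout_transfer wfH szW szW'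
  (fun u => (al u).1) (fun u => (al u).2) lay' deg2 mkS M'S.
apply: (layout_contains _ _ lay); first exact: wrel_sym.
exact: (@wrel_irr H m W wfH).
Qed.

Lemma all_In (T : Type) (p : pred T) s x : all p s -> List.In x s -> p x.
Proof. by elim: s => //= y s IH /andP[py /IH ps] [<-|/ps]. Qed.

(** Each word gives way to a short one with the same profile. Avoidance of [F] survives by
    [contains_profile]; spokes and legality of edges depend only on which letters occur. There are
    [2 ^ pg_nV H * 4] letters: a set of neighbours and two flags. *)
Theorem bounded_realization (H : pathograph) (F : seq pathograph) N :
    wf_pg H -> all wf_pg F -> pg_rungs H = [::] ->
    (forall Q, List.In Q F -> mark_bound (pg_nV H) (pg_nV Q) (pg_nU Q) <= N) ->
    has_Ffree_realization H F ->
  exists (m : 'I_(pg_nU H) -> nat) (r : rel (rvert H m)),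
    [/\ is_realization H m r, Ffree (rvert H m) r F &
        forall u, m u <= profile_count N (2 ^ pg_nV H * 4)].
Proof.
move=> wfH wfF norung leN [m0 [r0 [[[r0sym r0irr] r0base r0extra r0spoke r0rung] free]]].
have nr u u' : is_rung H u u' = false by rewrite /is_rung norung.
pose lab u i : {set 'I_(pg_nV H)} * (bool * bool) :=
  ([set v | r0 (inl v) (rpos m0 u i)], (i == 0, i == m0 u)).
pose W0 u := mkseq (lab u) (m0 u).+1.
have szW0 u : size (W0 u) = (m0 u).+1 by rewrite size_mkseq.
have onthW0 u i a : onth (W0 u) i = Some a -> i <= m0 u /\ a = lab u i.
  move=> E; have lti : i < (m0 u).+1 by rewrite -(szW0 u) -onthTE E.
  by split=> //; have := onth_nth (lab u 0) _ _ _ E; rewrite nth_mkseq.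
have flagW0 u : flagged (W0 u).
  by move=> i a /onthW0[lei ->]; rewrite szW0.
have r0E x y : r0 x y = @wrel H m0 W0 x y.
  have vp v u i : i <= m0 u -> r0 (inl v) (rpos m0 u i) = wrel W0 (inl v) (rpos m0 u i).
    by move=> lei; rewrite wrel_vpos // /row nth_mkseq // inE.
  case: (rvertP x) => [v|u i lei]; case: (rvertP y) => [v'|u' j lej].
  - by apply/idP/idP=> [/r0extra|h]; [rewrite /= orbF | apply: r0base].
  - exact: vp.
  - by rewrite r0sym wrel_sym vp.
  rewrite wrel_pospos // -(base_pospos lei lej); apply/idP/idP=> [/r0extra|]; last exact: r0base.
  by rewrite /= nr orbF.
have W0_gt0 u : 0 < size (W0 u) by rewrite szW0.
have /fin_all_exists[W WP] := fun u => shrink N (W0_gt0 u) (@flagW0 u).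
pose m u := (size (W u)).-1.
have szW u : size (W u) = (m u).+1.
  by have [/andP[gt0 _] _ _] := WP u; rewrite /m prednK.
have flagW u : flagged (W u) by have [_ + _] := WP u.
have eqp u : profile N (W u) = profile N (W0 u) by have [_ _] := WP u.
(* Taking no marks on [W u], equality of profiles shows that both words use the same letters. *)
have letters u : exists M, aligned (fun=> false) (W u) M (W0 u) /\
                           aligned M (W0 u) (fun=> false) (W u).
  have r0' n : rank (fun=> false) n = 0 by elim: n => //= n ->.
  have [||M [al al']] := @profile_aligned _ N (fun=> false) (W0 u) (W u).
  - by rewrite eqp.
  - by rewrite r0'.
  by exists M.
have baseE m1 W1 u i a v : (forall u, size (W1 u) = (m1 u).+1) -> flagged (W1 u) ->
    onth (W1 u) i = Some a -> i <= m1 u ->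
    base_adj H m1 (inl v) (rpos m1 u i) =
    (v == end1 H u :> nat) && a.2.1 || (v == end2 H u :> nat) && a.2.2.
  by move=> sz fl E lei; rewrite base_vpos // (fl _ _ E) sz.
(* A letter determines the edge to [v] and, through its flags, whether that is a path edge; both
   thus agree with some position of the original realization. *)
have down v u i : i <= m u -> exists2 j, j <= m0 u &
    r0 (inl v) (rpos m0 u j) = wrel W (inl v) (rpos m u i) /\
    base_adj H m0 (inl v) (rpos m0 u j) = base_adj H m (inl v) (rpos m u i).
  move=> lei; have [M [al _]] := letters u.
  have : onth (W u) i by rewrite onthTE szW ltnS.
  case E: (onth (W u) i) => [a|] // _; have [j [Ej _ _]] := al _ _ E.
  have [lej _] := onthW0 _ _ _ Ej; exists j => //.
  rewrite (baseE _ m W _ _ a) // (baseE _ m0 W0 _ _ a) // r0E !wrel_vpos // /row.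
  by rewrite (onth_nth _ _ _ _ E) (onth_nth _ _ _ _ Ej).
exists m, (@wrel H m W); split; last first.
- move=> u; have [/andP[_]] := WP u.
  rewrite szW ltnS => le _ _; apply: leq_trans le _.
  rewrite card_prod card_prod card_bool -[#|{set _}|]cardsT -powersetT card_powerset.
  by rewrite cardsT card_ord.
- move=> Q QF [m1 [r1 [real1 [f [finj ef]]]]]; apply: (free Q QF).
  have wfQ := all_In wfF QF.
  have [|m2 [r2 [real2 [f2 [f2inj ef2]]]]] := contains_profile wfH wfQ (leN Q QF) szW0 szW eqp.
    by exists m1, r1; split=> //; exists f.
  by exists m2, r2; split=> //; exists f2; split=> // x y; rewrite r0E.
split.
- by split=> [x y|x]; rewrite ?wrel_irr // wrel_sym.
- have vp v u i : i <= m u -> base_adj H m (inl v) (rpos m u i) -> wrel W (inl v) (rpos m u i).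
    by move=> lei; have [j lej [<- <-]] := down v u i lei; apply: r0base.
  move=> x y; case: (rvertP x) => [v|u i lei]; case: (rvertP y) => [v'|u' j lej].
  - by [].
  - exact: vp.
  - by rewrite base_adj_sym wrel_sym; apply: vp.
  by rewrite base_pospos // wrel_pospos.
- have vp v u i : i <= m u -> wrel W (inl v) (rpos m u i) ->
      base_adj H m (inl v) (rpos m u i) || is_spoke H v u.
    by move=> lei; have [j lej [<- <-]] := down v u i lei; apply: r0extra.
  move=> x y; case: (rvertP x) => [v|u i lei]; case: (rvertP y) => [v'|u' j lej].
  - by rewrite /= orbF.
  - exact: vp.
  - by rewrite base_adj_sym wrel_sym; apply: vp.
  by rewrite base_pospos // wrel_pospos // => ->.
(* Spokes use the reverse direction: the letter of a spoke edge in the long word occurs in the short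
   one. *)
- move=> v u /r0spoke[i]; rewrite -[i]inord_val -/(rpos m0 u i) => h.
  have lei : i <= m0 u by rewrite -ltnS.
  have [M [_ al']] := letters u.
  have : onth (W0 u) i by rewrite onthTE szW0.
  case E: (onth (W0 u) i) => [a|] // _; have [j [Ej _ _]] := al' _ _ E.
  have lej : j <= m u by rewrite -ltnS -szW -onthTE Ej.
  exists (inord j); rewrite -/(rpos m u j); move: h.
  rewrite (baseE _ m W _ _ a) // (baseE _ m0 W0 _ _ a) // r0E !wrel_vpos // /row.
  by rewrite (onth_nth _ _ _ _ E) (onth_nth _ _ _ _ Ej).
by move=> u u'; rewrite nr.
Qed.

(** * Primitive recursive functions *)

(* The arity [k] is fixed because [PComp] passes on only finitely many arguments,
   while primitive recursion needs the whole environment. *)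
Definition Comp (k : nat) (f : seq nat -> nat) : Prop :=
  exists p, forall xs, size xs = k -> eval p xs (f xs).

Lemma Comp_ext k f g : (forall xs, f xs = g xs) -> Comp k f -> Comp k g.
Proof. by move=> fg [p hp]; exists p => xs /hp; rewrite fg. Qed.

Lemma Comp_nth k i : Comp k (fun xs => nth 0 xs i).
Proof. by exists (PProj i) => xs _; apply: ev_proj. Qed.

Fixpoint CompAll (k : nat) (gs : seq (seq nat -> nat)) : Prop :=
  if gs is g :: gs' then Comp k g /\ CompAll k gs' else True.

Lemma Comp_comp k f gs : Comp (size gs) f -> CompAll k gs ->
  Comp k (fun xs => f [seq g xs | g <- gs]).
Proof.
move=> [p hp] hgs.
have [ps hps] : exists ps, forall xs, size xs = k -> evals ps xs [seq g xs | g <- gs].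
  elim: gs hgs {hp} => [|g gs IH] /=; first by exists [::] => xs _; apply: evs_nil.
  case=> [[pg hg] /IH[ps hps]]; exists (pg :: ps) => xs sz.
  by apply: evs_cons; [apply: hg | apply: hps].
exists (PComp p ps) => xs sz; apply: ev_comp (hps _ sz) _.
by apply: hp; rewrite size_map.
Qed.

Lemma CompAll_nths k (s : seq nat) : CompAll k [seq (fun xs => nth 0 xs i) | i <- s].
Proof. by elim: s => //= i s IH; split; first exact: Comp_nth. Qed.

(** A function verified once on projections becomes usable at any arguments, so it need not be
    unfolded inside larger definitions. *)
Lemma Comp_app1 F : Comp 1 (fun ys => F (nth 0 ys 0)) ->
  forall k a, Comp k a -> Comp k (fun xs => F (a xs)).
Proof. by move=> hF k a ha; apply: (@Comp_comp k _ [:: a] hF). Qed.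

Lemma Comp_app2 F : Comp 2 (fun ys => F (nth 0 ys 0) (nth 0 ys 1)) ->
  forall k a b, Comp k a -> Comp k b -> Comp k (fun xs => F (a xs) (b xs)).
Proof. by move=> hF k a b ha hb; apply: (@Comp_comp k _ [:: a; b] hF). Qed.

Lemma Comp_app3 F : Comp 3 (fun ys => F (nth 0 ys 0) (nth 0 ys 1) (nth 0 ys 2)) ->
  forall k a b c, Comp k a -> Comp k b -> Comp k c ->
  Comp k (fun xs => F (a xs) (b xs) (c xs)).
Proof. by move=> hF k a b c ha hb hc; apply: (@Comp_comp k _ [:: a; b; c] hF). Qed.

Lemma Comp_app4 F :
  Comp 4 (fun ys => F (nth 0 ys 0) (nth 0 ys 1) (nth 0 ys 2) (nth 0 ys 3)) ->
  forall k a b c d, Comp k a -> Comp k b -> Comp k c -> Comp k d ->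
  Comp k (fun xs => F (a xs) (b xs) (c xs) (d xs)).
Proof. by move=> hF k a b c d ha hb hc hd; apply: (@Comp_comp k _ [:: a; b; c; d] hF). Qed.

Lemma Comp_app5 F :
  Comp 5 (fun ys => F (nth 0 ys 0) (nth 0 ys 1) (nth 0 ys 2) (nth 0 ys 3) (nth 0 ys 4)) ->
  forall k a b c d e, Comp k a -> Comp k b -> Comp k c -> Comp k d -> Comp k e ->
  Comp k (fun xs => F (a xs) (b xs) (c xs) (d xs) (e xs)).
Proof.
by move=> hF k a b c d e ha hb hc hd he; apply: (@Comp_comp k _ [:: a; b; c; d; e] hF).
Qed.

Lemma Comp_app6 F :
  Comp 6 (fun ys => F (nth 0 ys 0) (nth 0 ys 1) (nth 0 ys 2) (nth 0 ys 3) (nth 0 ys 4)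
                      (nth 0 ys 5)) ->
  forall k a b c d e f, Comp k a -> Comp k b -> Comp k c -> Comp k d -> Comp k e -> Comp k f ->
  Comp k (fun xs => F (a xs) (b xs) (c xs) (d xs) (e xs) (f xs)).
Proof.
by move=> hF k a b c d e f ha hb hc hd he hf; apply: (@Comp_comp k _ [:: a; b; c; d; e; f] hF).
Qed.

Lemma Comp_S k f : Comp k f -> Comp k (fun xs => (f xs).+1).
Proof.
apply: (Comp_app1 (F := S)); exists PSucc => -[|x [|y xs]] //= _; exact: ev_succ.
Qed.

Lemma Comp_const k n : Comp k (fun=> n).
Proof.
elim: n => [|n IH]; first by exists PZero => xs _; apply: ev_zero.
exact: (Comp_S IH).
Qed.

Lemma nths_id (xs : seq nat) k j : size xs = k + j ->
  [seq g xs | g <- [seq (fun xs => nth 0 xs i) | i <- iota j k]] = drop j xs.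
Proof.
move=> sz; rewrite -map_comp; apply: (@eq_from_nth _ 0).
  by rewrite size_map size_iota size_drop sz addnK.
move=> i; rewrite size_map size_iota => lti.
by rewrite (nth_map 0) ?size_iota // nth_iota //= nth_drop.
Qed.

(** [PPrimRec] expects its counter in front of the parameters, so [n] is prepended to projections
    reproducing the environment. The step sees counter, previous value and environment, hence arity
    [k.+2]. *)
Lemma Comp_rec k n f g : Comp k n -> Comp k f ->
    Comp k.+2 (fun ys => g (nth 0 ys 0) (nth 0 ys 1) (behead (behead ys))) ->
  Comp k (fun xs => nat_rect (fun=> nat) (f xs) (fun i r => g i r xs) (n xs)).
Proof.
move=> hn [pf hf] [pg hg].
have hrec : Comp k.+1 (fun ys => nat_rect (fun=> nat) (f (behead ys))
    (fun i r => g i r (behead ys)) (nth 0 ys 0)).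
  exists (PPrimRec pf pg) => -[|m xs] //= [sz].
  elim: m => [|m IH]; first by apply: ev_rec0; apply: hf.
  by apply: ev_recS IH _; apply: (hg [:: m, _ & xs]); rewrite /= sz.
pose gs := n :: [seq (fun xs => nth 0 xs i) | i <- iota 0 k].
have szg : size gs = k.+1 by rewrite /= size_map size_iota.
rewrite -szg in hrec; have [p hp] := Comp_comp hrec (conj hn (CompAll_nths k (iota 0 k))).
exists p => xs sz; have := hp xs sz; rewrite /= nths_id ?addn0 //.
by rewrite drop0.
Qed.

Lemma Comp_add k f g : Comp k f -> Comp k g -> Comp k (fun xs => f xs + g xs).
Proof.
apply: Comp_app2; apply: Comp_ext (Comp_rec (Comp_nth _ 0) (Comp_nth _ 1)
  (g := fun _ r _ => r.+1) (Comp_S (Comp_nth _ 1))) => xs /=.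
by elim: (nth 0 xs 0) => //= m ->.
Qed.

Lemma Comp_mul k f g : Comp k f -> Comp k g -> Comp k (fun xs => f xs * g xs).
Proof.
apply: Comp_app2; apply: Comp_ext (Comp_rec (Comp_nth _ 0) (Comp_const _ 0)
  (g := fun _ r xs => nth 0 xs 1 + r) _) => [xs|] /=.
  by elim: (nth 0 xs 0) => //= m ->; rewrite mulSn.
by apply: Comp_add (Comp_nth _ 1); apply: Comp_ext (Comp_nth _ 3) => -[|? []].
Qed.

Lemma Comp_exp k f g : Comp k f -> Comp k g -> Comp k (fun xs => f xs ^ g xs).
Proof.
apply: Comp_app2; apply: Comp_ext (Comp_rec (Comp_nth _ 1) (Comp_const _ 1)
  (g := fun _ r xs => nth 0 xs 0 * r) _) => [xs|] /=.
  by elim: (nth 0 xs 1) => //= m ->; rewrite expnS.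
by apply: Comp_mul (Comp_nth _ 1); apply: Comp_ext (Comp_nth _ 2) => -[|? []].
Qed.

Lemma Comp_pred k f : Comp k f -> Comp k (fun xs => (f xs).-1).
Proof.
apply: (Comp_app1 (F := predn)); apply: Comp_ext (Comp_rec (Comp_nth _ 0) (Comp_const _ 0)
  (g := fun i _ _ => i) (Comp_nth _ 0)) => xs /=.
by case: (nth 0 xs 0).
Qed.

Lemma Comp_sub k f g : Comp k f -> Comp k g -> Comp k (fun xs => f xs - g xs).
Proof.
apply: Comp_app2; apply: Comp_ext (Comp_rec (Comp_nth _ 1) (Comp_nth _ 0)
  (g := fun _ r _ => r.-1) (Comp_pred (Comp_nth _ 1))) => xs /=.
by elim: (nth 0 xs 1) => [|m /= ->]; rewrite ?subn0 // subnS.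
Qed.

Lemma Comp_not k (b : seq nat -> bool) : Comp k b -> Comp k (fun xs => ~~ b xs).
Proof.
move=> hb; apply: Comp_ext (Comp_sub (Comp_const _ 1) hb) => xs; by case: (b xs).
Qed.

Lemma Comp_and k (b c : seq nat -> bool) : Comp k b -> Comp k c ->
  Comp k (fun xs => b xs && c xs).
Proof. by move=> hb hc; apply: Comp_ext (Comp_mul hb hc) => xs; rewrite mulnb. Qed.

Lemma Comp_or k (b c : seq nat -> bool) : Comp k b -> Comp k c ->
  Comp k (fun xs => b xs || c xs).
Proof.
move=> hb hc; apply: Comp_ext (Comp_not (Comp_and (Comp_not hb) (Comp_not hc))) => xs.
by rewrite negb_and !negbK.
Qed.

Lemma Comp_imp k (b c : seq nat -> bool) : Comp k b -> Comp k c ->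
  Comp k (fun xs => b xs ==> c xs).
Proof.
by move=> hb hc; apply: Comp_ext (Comp_or (Comp_not hb) hc) => xs; rewrite implybE.
Qed.

Lemma Comp_leq k f g : Comp k f -> Comp k g -> Comp k (fun xs => f xs <= g xs).
Proof.
move=> hf hg; apply: Comp_ext (Comp_sub (Comp_const _ 1) (Comp_sub hf hg)) => xs.
by rewrite /leq; case: (f xs - g xs).
Qed.

Lemma Comp_eq k f g : Comp k f -> Comp k g -> Comp k (fun xs => f xs == g xs).
Proof.
move=> hf hg; apply: Comp_ext (Comp_and (Comp_leq hf hg) (Comp_leq hg hf)) => xs.
by rewrite eqn_leq.
Qed.

Lemma Comp_eqb k (b c : seq nat -> bool) : Comp k b -> Comp k c ->
  Comp k (fun xs => b xs == c xs).
Proof.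
by move=> hb hc; apply: Comp_ext (Comp_eq hb hc) => xs; case: (b xs) (c xs) => -[].
Qed.

(** * Bounded sums and bounded quantifiers *)

Definition bsum (n : nat) (F : nat -> nat) := \sum_(i < n) F i.

Lemma eq_bsum n F G : (forall i, i < n -> F i = G i) -> bsum n F = bsum n G.
Proof. by move=> FG; apply: eq_bigr => i _; apply: FG. Qed.

Lemma bsum_ltn n x : x <= n -> bsum n (fun i => i < x) = x.
Proof.
move=> le_x; rewrite /bsum -(subnKC le_x) big_split_ord /= [X in _ + X]big1 ?addn0.
  rewrite (eq_bigr (fun=> 1)) => [|i _]; last by rewrite ltn_ord.
  by rewrite sum_nat_const card_ord muln1.
by move=> i _; rewrite ltnNge leq_addr.
Qed.

Lemma Comp_sum k n (h : nat -> seq nat -> nat) : Comp k n ->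
    Comp k.+1 (fun ys => h (nth 0 ys 0) (behead ys)) ->
  Comp k (fun xs => bsum (n xs) (fun i => h i xs)).
Proof.
rewrite /bsum; move=> hn hh; apply: Comp_ext (Comp_rec hn (Comp_const _ 0)
  (g := fun i r xs => r + h i xs) _) => [xs|].
  by elim: (n xs) => [|m IH]; rewrite ?big_ord0 // big_ord_recr /= IH.
apply: Comp_add (Comp_nth _ 1) _.
(* The body must not see the accumulator, which sits in position 1, so the projections jump from 0
   to 2. *)
pose gs := (fun ys => nth 0 ys 0) :: [seq (fun ys => nth 0 ys i) | i <- iota 2 k].
have szg : size gs = k.+1 by rewrite /= size_map size_iota.
rewrite -szg in hh.
have [p hp] := Comp_comp hh (conj (Comp_nth k.+2 0) (CompAll_nths k.+2 (iota 2 k))).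
exists p => xs sz; have := hp xs sz; rewrite /= nths_id ?sz ?addn2 //.
by case: xs sz => [|? [|? xs]] //=; rewrite drop0.
Qed.

Definition bex (n : nat) (P : pred nat) : bool := has P (iota 0 n).
Definition ball (n : nat) (P : pred nat) : bool := all P (iota 0 n).

Lemma bexP n (P : pred nat) : reflect (exists2 i, i < n & P i) (bex n P).
Proof.
by apply: (iffP hasP) => -[i]; rewrite ?mem_iota ?add0n => lti Pi; exists i; rewrite // mem_iota.
Qed.

Lemma ballP n (P : pred nat) : reflect (forall i, i < n -> P i) (ball n P).
Proof.
apply: (iffP allP) => h i lti; first by apply: h; rewrite mem_iota.
by apply: h; rewrite mem_iota in lti.
Qed.

Lemma Comp_bex k n (P : nat -> seq nat -> bool) : Comp k n ->
    Comp k.+1 (fun ys => P (nth 0 ys 0) (behead ys)) ->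
  Comp k (fun xs => bex (n xs) (fun i => P i xs)).
Proof.
move=> hn hP; apply: Comp_ext (Comp_leq (Comp_const _ 1)
  (Comp_sum hn (h := fun i xs => P i xs) hP)) => xs.
rewrite /bex /bsum has_count; congr (nat_of_bool (0 < _)); move: (n xs) => N.
elim: N => [|N IH]; first by rewrite big_ord0.
by rewrite big_ord_recr -[in RHS]addn1 iotaD count_cat -IH /= addn0.
Qed.

Lemma Comp_ball k n (P : nat -> seq nat -> bool) : Comp k n ->
    Comp k.+1 (fun ys => P (nth 0 ys 0) (behead ys)) ->
  Comp k (fun xs => ball (n xs) (fun i => P i xs)).
Proof.
move=> hn hP; apply: Comp_ext (Comp_not (Comp_bex (P := fun i xs => ~~ P i xs) hn (Comp_not hP))).
by move=> xs; rewrite /ball /bex -[has _ _]/(has (predC (P^~ xs)) _) has_predC negbK.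
Qed.

(** Evaluating a variable, an [nth] under several [behead], on the environment [0, 1, 2, ...]
    returns the index of the projection it denotes. *)
Ltac comp_var :=
  lazymatch goal with |- Comp ?k ?f =>
    let i := eval cbv in (f (iota 0 k)) in
    apply: (Comp_ext _ (Comp_nth k i)) => ? /=; rewrite ?nth_behead //
  end.

Create HintDb comp discriminated.
#[local] Hint Extern 0 (Comp _ (fun xs => nth 0 _ _)) => comp_var : comp.
#[local] Hint Extern 0 (Comp _ (fun _ => ?n)) => apply: Comp_const : comp.
#[local] Hint Extern 1 (Comp _ (fun xs => S _)) => apply: Comp_S; cbv beta : comp.
#[local] Hint Extern 1 (Comp _ (fun xs => addn _ _)) => apply: Comp_add; cbv beta : comp.
#[local] Hint Extern 1 (Comp _ (fun xs => muln _ _)) => apply: Comp_mul; cbv beta : comp.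
#[local] Hint Extern 1 (Comp _ (fun xs => subn _ _)) => apply: Comp_sub; cbv beta : comp.
#[local] Hint Extern 1 (Comp _ (fun xs => expn _ _)) => apply: Comp_exp; cbv beta : comp.
#[local] Hint Extern 1 (Comp _ (fun xs => nat_of_bool (andb _ _))) =>
  apply: Comp_and; cbv beta : comp.
#[local] Hint Extern 1 (Comp _ (fun xs => nat_of_bool (orb _ _))) =>
  apply: Comp_or; cbv beta : comp.
#[local] Hint Extern 1 (Comp _ (fun xs => nat_of_bool (negb _))) =>
  apply: Comp_not; cbv beta : comp.
#[local] Hint Extern 1 (Comp _ (fun xs => nat_of_bool (implb _ _))) =>
  apply: Comp_imp; cbv beta : comp.
#[local] Hint Extern 1 (Comp _ (fun xs => nat_of_bool (leq _ _))) =>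
  apply: Comp_leq; cbv beta : comp.
#[local] Hint Extern 1 (Comp _ (fun xs => nat_of_bool (@eq_op Datatypes_nat__canonical__eqtype_Equality _ _))) =>
  apply: Comp_eq; cbv beta : comp.
#[local] Hint Extern 1 (Comp _ (fun xs => nat_of_bool (@eq_op Datatypes_bool__canonical__eqtype_Equality _ _))) =>
  apply: Comp_eqb; cbv beta : comp.
#[local] Hint Extern 1 (Comp _ (fun xs => nat_of_bool (bex _ _))) =>
  apply: Comp_bex; cbv beta : comp.
#[local] Hint Extern 1 (Comp _ (fun xs => nat_of_bool (ball _ _))) =>
  apply: Comp_ball; cbv beta : comp.
#[local] Hint Extern 1 (Comp _ (fun xs => bsum _ _)) => apply: Comp_sum; cbv beta : comp.

Ltac comp := solve [cbv beta; auto 100 with comp nocore].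

Lemma Comp_div k f g : Comp k f -> Comp k g -> Comp k (fun xs => f xs %/ g xs).
Proof.
apply: Comp_app2.
(* The quotient counts the positive multiples of the divisor up to the dividend; the guard
   reproduces [x %/ 0 = 0]. *)
apply: (@Comp_ext _ (fun ys => bsum (nth 0 ys 0)
  (fun i => (0 < nth 0 ys 1) && (i.+1 * nth 0 ys 1 <= nth 0 ys 0)))).
  move=> ys; move: (nth 0 ys 0) (nth 0 ys 1) => x [|y]; first by rewrite /bsum big1 ?divn0.
  rewrite -[in RHS](@bsum_ltn x (x %/ y.+1)) ?leq_div //.
  by apply: eq_bsum => i _; rewrite leq_divRL.
by comp.
Qed.

Lemma Comp_mod k f g : Comp k f -> Comp k g -> Comp k (fun xs => f xs %% g xs).
Proof.
move=> hf hg; apply: Comp_ext (Comp_sub hf (Comp_mul (Comp_div hf hg) hg)) => xs.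
by rewrite {1}(divn_eq (f xs) (g xs)) addKn.
Qed.

#[local] Hint Extern 1 (Comp _ (fun xs => divn _ _)) => apply: Comp_div; cbv beta : comp.
#[local] Hint Extern 1 (Comp _ (fun xs => modn _ _)) => apply: Comp_mod; cbv beta : comp.

(** * Arithmetized search *)

(** [CodeSeq.code] sends [x :: s] to [2 ^ x] times an odd number, one more than twice the code of
    [s]. The head is thus the 2-adic valuation, found by counting the powers of two that divide
    [c]. *)
Definition chead (c : nat) := bsum c (fun i => c %% 2 ^ i.+1 == 0).
Definition ctail (c : nat) := c %/ 2 ^ (chead c).+1.
Definition cdrop (i c : nat) := iter i ctail c.
Definition celt (c i : nat) := chead (cdrop i c).
(** Nonempty lists have nonzero codes, so [cdrop i c != 0] separates an entry from the default 0
    past the end. *)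
Definition cmem (c z : nat) := bex c (fun i => (cdrop i c != 0) && (celt c i == z)).
Definition cpair (a b : nat) := 2 ^ a * (2 ^ b * 2 + 1).

Lemma chead_cons x s : chead (CodeSeq.code (x :: s)) = x.
Proof.
rewrite /chead /=; set c := (X in 2 ^ x * X).
have c_odd : odd c by rewrite /c /= odd_double.
have lt_x : x <= 2 ^ x * c.
  by rewrite (leq_trans (ltnW (ltn_expl x (isT : 1 < 2)))) // leq_pmulr // odd_gt0.
rewrite -[RHS](bsum_ltn lt_x); apply: eq_bsum.
move=> i _; congr nat_of_bool; rewrite -/(2 ^ i.+1 %| 2 ^ x * c).
have c_gt0 : 0 < c by [].
rewrite pfactor_dvdn ?muln_gt0 ?expn_gt0 // lognM ?expn_gt0 // pfactorK //.
by rewrite [logn 2 c]logn_coprime ?addn0 // coprime2n.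
Qed.

Lemma ctail_cons x s : ctail (CodeSeq.code (x :: s)) = CodeSeq.code s.
Proof.
rewrite /ctail chead_cons expnSr [CodeSeq.code _]/= divnMl ?expn_gt0 //.
by rewrite -addn1 -muln2 divnMDl // divn_small // addn0.
Qed.

Lemma cdrop_code i s : cdrop i (CodeSeq.code s) = CodeSeq.code (drop i s).
Proof.
rewrite /cdrop; elim: i s => [|i IH] s; first by rewrite drop0.
case: s => [|x s]; last by rewrite iterSr ctail_cons IH.
by rewrite iterSr [ctail _]div0n (IH [::]).
Qed.

Lemma code_eq0 s : (CodeSeq.code s == 0) = nilp s.
Proof. by case: s => //= x s; rewrite muln_eq0 expn_eq0. Qed.

Lemma celt_code s i : celt (CodeSeq.code s) i = nth 0 s i.
Proof.
rewrite /celt cdrop_code -[in RHS](addn0 i) -nth_drop.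
by case: (drop i s) => [|x t]; rewrite ?chead_cons //= /chead /bsum big_ord0.
Qed.

Lemma size_code s : size s <= CodeSeq.code s.
Proof.
elim: s => //= x s IH; apply: (@leq_trans (CodeSeq.code s).*2.+1).
  by rewrite ltnS (leq_trans IH) // -addnn leq_addr.
by rewrite leq_pmull // expn_gt0.
Qed.

Lemma cmem_code s z : cmem (CodeSeq.code s) z = (z \in s).
Proof.
apply/bexP/idP=> [[i _]|/(nthP 0)[i lti <-]].
  rewrite cdrop_code code_eq0 celt_code /nilp size_drop subn_eq0 -ltnNge => /andP[lti /eqP<-].
  exact: mem_nth.
exists i; first exact: leq_trans lti (size_code s).
by rewrite cdrop_code code_eq0 celt_code /nilp size_drop subn_eq0 -ltnNge lti /=.
Qed.

Lemma cpairE (a b : nat) : cpair a b = pickle (a, b).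
Proof. by rewrite /cpair addn1 muln2 -[in LHS](muln1 (2 ^ b)). Qed.

Definition cfst (q : nat) := celt q 0.
Definition csnd (q : nat) := celt q 1.

Lemma cfst_pickle (T1 T2 : countType) (x : T1) (y : T2) : cfst (pickle (x, y)) = pickle x.
Proof. exact: (celt_code [:: pickle x; pickle y] 0). Qed.

Lemma csnd_pickle (T1 T2 : countType) (x : T1) (y : T2) : csnd (pickle (x, y)) = pickle y.
Proof. exact: (celt_code [:: pickle x; pickle y] 1). Qed.

Definition cnV (q : nat) := cfst (cfst (cfst (cfst (cfst q)))).
Definition cnU (q : nat) := csnd (cfst (cfst (cfst (cfst q)))).
Definition cedge (q a b : nat) :=
  cmem (csnd (cfst (cfst (cfst q)))) (cpair a b) || cmem (csnd (cfst (cfst (cfst q)))) (cpair b a).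
Definition cspoke (q v u : nat) := cmem (csnd (cfst (cfst q))) (cpair v u).
Definition crung (q u u' : nat) :=
  cmem (csnd (cfst q)) (cpair u u') || cmem (csnd (cfst q)) (cpair u' u).
Definition cend1 (q u : nat) := cfst (celt (csnd q) u).
Definition cend2 (q u : nat) := csnd (celt (csnd q) u).

Section PathographCode.

Variable P : pathograph.
Local Notation q := (pg_code P).

Lemma cmem_pairs (s : seq (nat * nat)) a b : cmem (pickle s) (cpair a b) = ((a, b) \in s).
Proof.
rewrite cpairE cmem_code mem_map //; exact: pcan_inj pickleK.
Qed.

Lemma cnVE : cnV q = pg_nV P.
Proof. by rewrite /cnV !cfst_pickle. Qed.

Lemma cnUE : cnU q = pg_nU P.
Proof. by rewrite /cnU !cfst_pickle csnd_pickle. Qed.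

Lemma cedgeE a b : cedge q a b = is_edge P a b.
Proof. by rewrite /cedge !cfst_pickle csnd_pickle !cmem_pairs. Qed.

Lemma cspokeE v u : cspoke q v u = is_spoke P v u.
Proof. by rewrite /cspoke !cfst_pickle csnd_pickle cmem_pairs. Qed.

Lemma crungE u u' : crung q u u' = is_rung P u u'.
Proof. by rewrite /crung !cfst_pickle csnd_pickle !cmem_pairs. Qed.

Lemma celt_ends u : u < size (pg_ends P) ->
  celt (csnd q) u = pickle (nth (0, 0) (pg_ends P) u).
Proof. by move=> ltu; rewrite csnd_pickle celt_code (nth_map (0, 0)). Qed.

Lemma cend1E u : u < size (pg_ends P) -> cend1 q u = end1 P u.
Proof.
by move=> ltu; rewrite /cend1 celt_ends // /end1; case: (nth _ _ _) => a b; rewrite cfst_pickle.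
Qed.

Lemma cend2E u : u < size (pg_ends P) -> cend2 q u = end2 P u.
Proof.
by move=> ltu; rewrite /cend2 celt_ends // /end2; case: (nth _ _ _) => a b; rewrite csnd_pickle.
Qed.

Lemma pickle_fst_leq (T1 T2 : countType) (x : T1) (y : T2) : pickle x <= pickle (x, y).
Proof.
have /allP/(_ (pickle x)) := CodeSeq.ltn_code [:: pickle x; pickle y].
by rewrite mem_head => /(_ isT)/ltnW.
Qed.

Lemma pickle_snd_leq (T1 T2 : countType) (x : T1) (y : T2) : pickle y <= pickle (x, y).
Proof.
have /allP/(_ (pickle y)) := CodeSeq.ltn_code [:: pickle x; pickle y].
by rewrite !inE eqxx orbT => /(_ isT)/ltnW.
Qed.

Lemma nV_leq_code : pg_nV P <= q.
Proof.
by do 4![apply: leq_trans (pickle_fst_leq _ _)]; apply: (@pickle_fst_leq nat nat).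
Qed.

Lemma nU_leq_code : pg_nU P <= q.
Proof.
by do 4![apply: leq_trans (pickle_fst_leq _ _)]; apply: (@pickle_snd_leq nat nat).
Qed.

End PathographCode.

Definition cdig (b z i : nat) := z %/ b ^ i %% b.

(** Finite functions become digit strings, which turns a search over functions into one over numbers
    below [b ^ n]. *)
Lemma cdig_exists b n (f : nat -> nat) : (forall i, i < n -> f i < b) ->
  exists2 z, z < b ^ n & forall i, i < n -> cdig b z i = f i.
Proof.
elim: n f => [|n IH] f lt_f; first by exists 0.
have [i lti|z ltz zf] := IH (fun i => f i.+1); first exact: lt_f.
have f0 := lt_f 0 isT; have b0 : 0 < b by apply: leq_ltn_trans f0.
exists (z * b + f 0).
  rewrite expnSr; apply: (@leq_trans (z.+1 * b)); last by rewrite leq_mul2r ltz orbT.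
  by rewrite mulSn addnC ltn_add2r.
case=> [|i] lti; rewrite /cdig; first by rewrite divn1 modnMDl modn_small.
by rewrite expnS divnMA divnMDl // (divn_small f0) addn0 -zf.
Qed.

(* With stride [K] exceeding all path lengths, the vertex [v] of a realization is coded
   by [v] and the internal vertex [(u, i)] by [nV + u * K + i]; the lengths and the
   relation are the digits of [mc] and [rc]. *)
Definition csize (q K : nat) := cnV q + cnU q * K.
Definition curp (q K x : nat) := (x - cnV q) %/ K.
Definition cidx (q K x : nat) := (x - cnV q) %% K.
(** With a fixed stride some numbers code no vertex: those whose index exceeds the length of their
    urpath. *)
Definition cvalid (q K mc x : nat) :=
  (x < cnV q) || ((curp q K x < cnU q) && (cidx q K x <= cdig K mc (curp q K x))).
Definition catend (q K mc v x : nat) :=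
  (v == cend1 q (curp q K x)) && (cidx q K x == 0) ||
  (v == cend2 q (curp q K x)) && (cidx q K x == cdig K mc (curp q K x)).
Definition cbase (q K mc x y : nat) :=
  [|| [&& x < cnV q, y < cnV q & cedge q x y],
      [&& x < cnV q, cnV q <= y & catend q K mc x y],
      [&& cnV q <= x, y < cnV q & catend q K mc y x] |
      [&& cnV q <= x, cnV q <= y, curp q K x == curp q K y &
          ((cidx q K x).+1 == cidx q K y) || ((cidx q K y).+1 == cidx q K x)]].
Definition cextra (q K x y : nat) :=
  [|| [&& x < cnV q, cnV q <= y & cspoke q x (curp q K y)],
      [&& cnV q <= x, y < cnV q & cspoke q y (curp q K x)] |
      [&& cnV q <= x, cnV q <= y & crung q (curp q K x) (curp q K y)]].
Definition crel (Z rc x y : nat) := cdig 2 rc (x * Z + y) == 1.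
Definition cpos (q K u i : nat) := cnV q + u * K + i.
Definition clocal (q K mc rc x y : nat) :=
  [&& crel (csize q K) rc x y == crel (csize q K) rc y x, ~~ crel (csize q K) rc x x,
      cbase q K mc x y ==> crel (csize q K) rc x y &
      crel (csize q K) rc x y ==> cbase q K mc x y || cextra q K x y].
Definition creal_local (q K mc rc : nat) :=
  ball (csize q K) (fun x => ball (csize q K) (fun y =>
    cvalid q K mc x && cvalid q K mc y ==> clocal q K mc rc x y)).
Definition creal_spoke (q K mc rc : nat) :=
  ball (cnV q) (fun v => ball (cnU q) (fun u => cspoke q v u ==>
    bex K (fun i => [&& i <= cdig K mc u, crel (csize q K) rc v (cpos q K u i) &
                        ~~ cbase q K mc v (cpos q K u i)]))).
Definition creal_rung (q K mc rc : nat) :=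
  ball (cnU q) (fun u => ball (cnU q) (fun u' => crung q u u' ==>
    bex K (fun i => bex K (fun j => [&& i <= cdig K mc u, j <= cdig K mc u' &
      crel (csize q K) rc (cpos q K u i) (cpos q K u' j)])))).
Definition creal (q K mc rc : nat) :=
  [&& creal_local q K mc rc, creal_spoke q K mc rc & creal_rung q K mc rc].

(** An urpath of an embedded [Q] has distinct images among [csize h K] codes, so [(csize h K).+1] is
    a sufficient stride for [Q]; it is also the digit base of the embedding [fc], whose values are
    host codes. *)
Definition cembed (q h K mc rc mc' rc' fc : nat) :=
  ball (csize q (csize h K).+1) (fun x => ball (csize q (csize h K).+1) (fun y =>
    cvalid q (csize h K).+1 mc' x && cvalid q (csize h K).+1 mc' y ==>
    [&& cvalid h K mc (cdig (csize h K).+1 fc x),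
        crel (csize q (csize h K).+1) rc' x y ==
        crel (csize h K) rc (cdig (csize h K).+1 fc x) (cdig (csize h K).+1 fc y) &
        (cdig (csize h K).+1 fc x == cdig (csize h K).+1 fc y) ==> (x == y)])).
Definition ccont (q h K mc rc : nat) :=
  bex ((csize h K).+1 ^ cnU q) (fun mc' =>
  bex (2 ^ (csize q (csize h K).+1 * csize q (csize h K).+1)) (fun rc' =>
  bex ((csize h K).+1 ^ csize q (csize h K).+1) (fun fc =>
    creal q (csize h K).+1 mc' rc' && cembed q h K mc rc mc' rc' fc))).

(* [mark_bound] and [profile_count] with every parameter bounded by the codes. *)
Definition cmarks (C : nat) := C + 2 * C + 2 * C + C * C + 2 * (C * C).
Definition cbound (C : nat) :=
  2 ^ ((cmarks C).+1 * 2 ^ ((cmarks C).+1 * 2 * (2 ^ C * 4))).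
Definition cdecide_at (h c K : nat) :=
  bex (K ^ cnU h) (fun mc => bex (2 ^ (csize h K * csize h K)) (fun rc =>
    creal h K mc rc &&
    ball c (fun i => (cdrop i c != 0) ==> ~~ ccont (celt c i) h K mc rc))).
(** [h + c] dominates the size parameters of [H] and of every member of [F]; the successor makes the
    stride exceed the bounded path lengths. *)
Definition cdecide (h c : nat) := cdecide_at h c (cbound (h + c)).+1.

(** * Recursiveness of the search predicates *)

Lemma Comp_chead k a : Comp k a ->
  Comp k (fun xs => chead (a xs)).
Proof. by apply: (Comp_app1 (F := chead)); rewrite /chead; comp. Qed.
#[local] Hint Extern 1 (Comp _ (fun xs => chead _)) => apply: Comp_chead; cbv beta : comp.

Lemma Comp_ctail k a : Comp k a ->
  Comp k (fun xs => ctail (a xs)).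
Proof. by apply: (Comp_app1 (F := ctail)); rewrite /ctail; comp. Qed.
#[local] Hint Extern 1 (Comp _ (fun xs => ctail _)) => apply: Comp_ctail; cbv beta : comp.

Lemma Comp_cdrop k a b : Comp k a -> Comp k b -> Comp k (fun xs => cdrop (a xs) (b xs)).
Proof.
apply: (Comp_app2 (F := cdrop)).
apply: (@Comp_ext _ (fun xs => nat_rect (fun=> nat) (nth 0 xs 1) (fun _ r => ctail r) (nth 0 xs 0))).
  by move=> xs; rewrite /cdrop; elim: (nth 0 xs 0) => //= i ->.
by apply: (Comp_rec (g := fun _ r _ => ctail r)); comp.
Qed.
#[local] Hint Extern 1 (Comp _ (fun xs => cdrop _ _)) => apply: Comp_cdrop; cbv beta : comp.

Lemma Comp_celt k a b : Comp k a -> Comp k b ->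
  Comp k (fun xs => celt (a xs) (b xs)).
Proof. by apply: (Comp_app2 (F := celt)); rewrite /celt; comp. Qed.
#[local] Hint Extern 1 (Comp _ (fun xs => celt _ _)) => apply: Comp_celt; cbv beta : comp.

Lemma Comp_cpair k a b : Comp k a -> Comp k b ->
  Comp k (fun xs => cpair (a xs) (b xs)).
Proof. by apply: (Comp_app2 (F := cpair)); rewrite /cpair; comp. Qed.
#[local] Hint Extern 1 (Comp _ (fun xs => cpair _ _)) => apply: Comp_cpair; cbv beta : comp.

Lemma Comp_cmem k a b : Comp k a -> Comp k b ->
  Comp k (fun xs => cmem (a xs) (b xs)).
Proof. by apply: (Comp_app2 (F := fun a b => cmem a b)); rewrite /cmem; comp. Qed.
#[local] Hint Extern 1 (Comp _ (fun xs => nat_of_bool (cmem _ _))) =>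
  apply: Comp_cmem; cbv beta : comp.

Lemma Comp_cfst k a : Comp k a ->
  Comp k (fun xs => cfst (a xs)).
Proof. by apply: (Comp_app1 (F := cfst)); rewrite /cfst; comp. Qed.
#[local] Hint Extern 1 (Comp _ (fun xs => cfst _)) => apply: Comp_cfst; cbv beta : comp.

Lemma Comp_csnd k a : Comp k a ->
  Comp k (fun xs => csnd (a xs)).
Proof. by apply: (Comp_app1 (F := csnd)); rewrite /csnd; comp. Qed.
#[local] Hint Extern 1 (Comp _ (fun xs => csnd _)) => apply: Comp_csnd; cbv beta : comp.

Lemma Comp_cnV k a : Comp k a ->
  Comp k (fun xs => cnV (a xs)).
Proof. by apply: (Comp_app1 (F := cnV)); rewrite /cnV; comp. Qed.
#[local] Hint Extern 1 (Comp _ (fun xs => cnV _)) => apply: Comp_cnV; cbv beta : comp.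

Lemma Comp_cnU k a : Comp k a ->
  Comp k (fun xs => cnU (a xs)).
Proof. by apply: (Comp_app1 (F := cnU)); rewrite /cnU; comp. Qed.
#[local] Hint Extern 1 (Comp _ (fun xs => cnU _)) => apply: Comp_cnU; cbv beta : comp.

Lemma Comp_cedge k a b c : Comp k a -> Comp k b -> Comp k c ->
  Comp k (fun xs => cedge (a xs) (b xs) (c xs)).
Proof. by apply: (Comp_app3 (F := fun a b c => cedge a b c)); rewrite /cedge; comp. Qed.
#[local] Hint Extern 1 (Comp _ (fun xs => nat_of_bool (cedge _ _ _))) =>
  apply: Comp_cedge; cbv beta : comp.

Lemma Comp_cspoke k a b c : Comp k a -> Comp k b -> Comp k c ->
  Comp k (fun xs => cspoke (a xs) (b xs) (c xs)).
Proof. by apply: (Comp_app3 (F := fun a b c => cspoke a b c)); rewrite /cspoke; comp. Qed.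
#[local] Hint Extern 1 (Comp _ (fun xs => nat_of_bool (cspoke _ _ _))) =>
  apply: Comp_cspoke; cbv beta : comp.

Lemma Comp_crung k a b c : Comp k a -> Comp k b -> Comp k c ->
  Comp k (fun xs => crung (a xs) (b xs) (c xs)).
Proof. by apply: (Comp_app3 (F := fun a b c => crung a b c)); rewrite /crung; comp. Qed.
#[local] Hint Extern 1 (Comp _ (fun xs => nat_of_bool (crung _ _ _))) =>
  apply: Comp_crung; cbv beta : comp.

Lemma Comp_cend1 k a b : Comp k a -> Comp k b ->
  Comp k (fun xs => cend1 (a xs) (b xs)).
Proof. by apply: (Comp_app2 (F := cend1)); rewrite /cend1; comp. Qed.
#[local] Hint Extern 1 (Comp _ (fun xs => cend1 _ _)) => apply: Comp_cend1; cbv beta : comp.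

Lemma Comp_cend2 k a b : Comp k a -> Comp k b ->
  Comp k (fun xs => cend2 (a xs) (b xs)).
Proof. by apply: (Comp_app2 (F := cend2)); rewrite /cend2; comp. Qed.
#[local] Hint Extern 1 (Comp _ (fun xs => cend2 _ _)) => apply: Comp_cend2; cbv beta : comp.

Lemma Comp_cdig k a b c : Comp k a -> Comp k b -> Comp k c ->
  Comp k (fun xs => cdig (a xs) (b xs) (c xs)).
Proof. by apply: (Comp_app3 (F := cdig)); rewrite /cdig; comp. Qed.
#[local] Hint Extern 1 (Comp _ (fun xs => cdig _ _ _)) => apply: Comp_cdig; cbv beta : comp.

Lemma Comp_csize k a b : Comp k a -> Comp k b ->
  Comp k (fun xs => csize (a xs) (b xs)).
Proof. by apply: (Comp_app2 (F := csize)); rewrite /csize; comp. Qed.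
#[local] Hint Extern 1 (Comp _ (fun xs => csize _ _)) => apply: Comp_csize; cbv beta : comp.

Lemma Comp_curp k a b c : Comp k a -> Comp k b -> Comp k c ->
  Comp k (fun xs => curp (a xs) (b xs) (c xs)).
Proof. by apply: (Comp_app3 (F := curp)); rewrite /curp; comp. Qed.
#[local] Hint Extern 1 (Comp _ (fun xs => curp _ _ _)) => apply: Comp_curp; cbv beta : comp.

Lemma Comp_cidx k a b c : Comp k a -> Comp k b -> Comp k c ->
  Comp k (fun xs => cidx (a xs) (b xs) (c xs)).
Proof. by apply: (Comp_app3 (F := cidx)); rewrite /cidx; comp. Qed.
#[local] Hint Extern 1 (Comp _ (fun xs => cidx _ _ _)) => apply: Comp_cidx; cbv beta : comp.

Lemma Comp_cvalid k a b c d : Comp k a -> Comp k b -> Comp k c -> Comp k d ->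
  Comp k (fun xs => cvalid (a xs) (b xs) (c xs) (d xs)).
Proof. by apply: (Comp_app4 (F := fun a b c d => cvalid a b c d)); rewrite /cvalid; comp. Qed.
#[local] Hint Extern 1 (Comp _ (fun xs => nat_of_bool (cvalid _ _ _ _))) =>
  apply: Comp_cvalid; cbv beta : comp.

Lemma Comp_catend k a b c d e : Comp k a -> Comp k b -> Comp k c -> Comp k d -> Comp k e ->
  Comp k (fun xs => catend (a xs) (b xs) (c xs) (d xs) (e xs)).
Proof. by apply: (Comp_app5 (F := fun a b c d e => catend a b c d e)); rewrite /catend; comp. Qed.
#[local] Hint Extern 1 (Comp _ (fun xs => nat_of_bool (catend _ _ _ _ _))) =>
  apply: Comp_catend; cbv beta : comp.

Lemma Comp_cbase k a b c d e : Comp k a -> Comp k b -> Comp k c -> Comp k d -> Comp k e ->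
  Comp k (fun xs => cbase (a xs) (b xs) (c xs) (d xs) (e xs)).
Proof. by apply: (Comp_app5 (F := fun a b c d e => cbase a b c d e)); rewrite /cbase; comp. Qed.
#[local] Hint Extern 1 (Comp _ (fun xs => nat_of_bool (cbase _ _ _ _ _))) =>
  apply: Comp_cbase; cbv beta : comp.

Lemma Comp_cextra k a b c d : Comp k a -> Comp k b -> Comp k c -> Comp k d ->
  Comp k (fun xs => cextra (a xs) (b xs) (c xs) (d xs)).
Proof. by apply: (Comp_app4 (F := fun a b c d => cextra a b c d)); rewrite /cextra; comp. Qed.
#[local] Hint Extern 1 (Comp _ (fun xs => nat_of_bool (cextra _ _ _ _))) =>
  apply: Comp_cextra; cbv beta : comp.

Lemma Comp_crel k a b c d : Comp k a -> Comp k b -> Comp k c -> Comp k d ->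
  Comp k (fun xs => crel (a xs) (b xs) (c xs) (d xs)).
Proof. by apply: (Comp_app4 (F := fun a b c d => crel a b c d)); rewrite /crel; comp. Qed.
#[local] Hint Extern 1 (Comp _ (fun xs => nat_of_bool (crel _ _ _ _))) =>
  apply: Comp_crel; cbv beta : comp.

Lemma Comp_cpos k a b c d : Comp k a -> Comp k b -> Comp k c -> Comp k d ->
  Comp k (fun xs => cpos (a xs) (b xs) (c xs) (d xs)).
Proof. by apply: (Comp_app4 (F := cpos)); rewrite /cpos; comp. Qed.
#[local] Hint Extern 1 (Comp _ (fun xs => cpos _ _ _ _)) => apply: Comp_cpos; cbv beta : comp.

Lemma Comp_clocal k a b c d e f : Comp k a -> Comp k b -> Comp k c -> Comp k d -> Comp k e -> Comp k f ->
  Comp k (fun xs => clocal (a xs) (b xs) (c xs) (d xs) (e xs) (f xs)).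
Proof. by apply: (Comp_app6 (F := fun a b c d e f => clocal a b c d e f)); rewrite /clocal; comp. Qed.
#[local] Hint Extern 1 (Comp _ (fun xs => nat_of_bool (clocal _ _ _ _ _ _))) =>
  apply: Comp_clocal; cbv beta : comp.

Lemma Comp_creal_local k a b c d : Comp k a -> Comp k b -> Comp k c -> Comp k d ->
  Comp k (fun xs => creal_local (a xs) (b xs) (c xs) (d xs)).
Proof. by apply: (Comp_app4 (F := fun a b c d => creal_local a b c d)); rewrite /creal_local; comp. Qed.
#[local] Hint Extern 1 (Comp _ (fun xs => nat_of_bool (creal_local _ _ _ _))) =>
  apply: Comp_creal_local; cbv beta : comp.

Lemma Comp_creal_spoke k a b c d : Comp k a -> Comp k b -> Comp k c -> Comp k d ->
  Comp k (fun xs => creal_spoke (a xs) (b xs) (c xs) (d xs)).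
Proof. by apply: (Comp_app4 (F := fun a b c d => creal_spoke a b c d)); rewrite /creal_spoke; comp. Qed.
#[local] Hint Extern 1 (Comp _ (fun xs => nat_of_bool (creal_spoke _ _ _ _))) =>
  apply: Comp_creal_spoke; cbv beta : comp.

Lemma Comp_creal_rung k a b c d : Comp k a -> Comp k b -> Comp k c -> Comp k d ->
  Comp k (fun xs => creal_rung (a xs) (b xs) (c xs) (d xs)).
Proof. by apply: (Comp_app4 (F := fun a b c d => creal_rung a b c d)); rewrite /creal_rung; comp. Qed.
#[local] Hint Extern 1 (Comp _ (fun xs => nat_of_bool (creal_rung _ _ _ _))) =>
  apply: Comp_creal_rung; cbv beta : comp.

Lemma Comp_creal k a b c d : Comp k a -> Comp k b -> Comp k c -> Comp k d ->
  Comp k (fun xs => creal (a xs) (b xs) (c xs) (d xs)).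
Proof. by apply: (Comp_app4 (F := fun a b c d => creal a b c d)); rewrite /creal; comp. Qed.
#[local] Hint Extern 1 (Comp _ (fun xs => nat_of_bool (creal _ _ _ _))) =>
  apply: Comp_creal; cbv beta : comp.

Lemma Comp_ccont k a b c d e : Comp k a -> Comp k b -> Comp k c -> Comp k d -> Comp k e ->
  Comp k (fun xs => ccont (a xs) (b xs) (c xs) (d xs) (e xs)).
Proof. by apply: (Comp_app5 (F := fun a b c d e => ccont a b c d e)); rewrite /ccont /cembed; comp. Qed.
#[local] Hint Extern 1 (Comp _ (fun xs => nat_of_bool (ccont _ _ _ _ _))) =>
  apply: Comp_ccont; cbv beta : comp.

Lemma Comp_cmarks k a : Comp k a ->
  Comp k (fun xs => cmarks (a xs)).
Proof. by apply: (Comp_app1 (F := cmarks)); rewrite /cmarks; comp. Qed.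
#[local] Hint Extern 1 (Comp _ (fun xs => cmarks _)) => apply: Comp_cmarks; cbv beta : comp.

Lemma Comp_cbound k a : Comp k a ->
  Comp k (fun xs => cbound (a xs)).
Proof. by apply: (Comp_app1 (F := cbound)); rewrite /cbound; comp. Qed.
#[local] Hint Extern 1 (Comp _ (fun xs => cbound _)) => apply: Comp_cbound; cbv beta : comp.

Lemma Comp_cdecide_at k a b c : Comp k a -> Comp k b -> Comp k c ->
  Comp k (fun xs => cdecide_at (a xs) (b xs) (c xs)).
Proof. by apply: (Comp_app3 (F := fun a b c => cdecide_at a b c)); rewrite /cdecide_at; comp. Qed.
#[local] Hint Extern 1 (Comp _ (fun xs => nat_of_bool (cdecide_at _ _ _))) =>
  apply: Comp_cdecide_at; cbv beta : comp.

Lemma Comp_cdecide k a b : Comp k a -> Comp k b ->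
  Comp k (fun xs => cdecide (a xs) (b xs)).
Proof. by apply: (Comp_app2 (F := fun a b => cdecide a b)); rewrite /cdecide; comp. Qed.
#[local] Hint Extern 1 (Comp _ (fun xs => nat_of_bool (cdecide _ _))) =>
  apply: Comp_cdecide; cbv beta : comp.

(** * Correctness of the numerical encoding *)

Section Encoding.

Variables (P : pathograph) (m : 'I_(pg_nU P) -> nat) (K mc : nat).
Hypothesis wfP : wf_pg P.
Hypothesis ltK : forall u, m u < K.
Hypothesis mcE : forall u : 'I_(pg_nU P), cdig K mc u = m u.
Local Notation q := (pg_code P).

Definition enc (x : rvert P m) : nat :=
  rfold (fun v => v : nat) (fun u i => pg_nV P + u * K + i) x.

Lemma enc_pos u i : i <= m u -> enc (rpos m u i) = cpos q K u i.
Proof. by move=> lei; rewrite /enc rfold_pos // /cpos cnVE. Qed.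

Lemma curp_cpos u i : i < K -> curp q K (cpos q K u i) = u.
Proof.
move=> lti; have K_gt0 : 0 < K by apply: leq_ltn_trans lti.
by rewrite /curp /cpos -addnA addKn divnMDl // divn_small // addn0.
Qed.

Lemma cidx_cpos u i : i < K -> cidx q K (cpos q K u i) = i.
Proof. by move=> lti; rewrite /cidx /cpos -addnA addKn modnMDl modn_small. Qed.

Lemma leq_cpos u i : cnV q <= cpos q K u i.
Proof. by rewrite /cpos -addnA leq_addr. Qed.

Lemma enc_lt x : enc x < csize q K.
Proof.
rewrite /csize cnVE cnUE; case: (rvertP x) => [v|u i lei].
  by rewrite (leq_trans (ltn_ord v)) // leq_addr.
rewrite enc_pos // /cpos cnVE -addnA ltn_add2l.
apply: (@leq_trans (u.+1 * K)); last by rewrite leq_mul2r ltn_ord orbT.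
by rewrite mulSn addnC ltn_add2r; apply: leq_ltn_trans (ltK u).
Qed.

Lemma cvalid_enc x : cvalid q K mc (enc x).
Proof.
rewrite /cvalid; case: (rvertP x) => [v|u i lei]; first by rewrite cnVE ltn_ord.
have lti : i < K by apply: leq_ltn_trans (ltK u).
by rewrite enc_pos // curp_cpos // cidx_cpos // cnUE ltn_ord mcE lei orbT.
Qed.

Lemma enc_onto y : cvalid q K mc y -> exists x, enc x = y.
Proof.
rewrite /cvalid cnVE cnUE; case: ltnP => [ltv _|leV /= /andP[ltu]].
  by exists (inl (Ordinal ltv)).
rewrite -[curp q K y]/(nat_of_ord (Ordinal ltu)) mcE => lei.
exists (rpos m (Ordinal ltu) (cidx q K y)); rewrite enc_pos // /cpos /=.
by rewrite -addnA /curp /cidx -divn_eq cnVE subnKC.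
Qed.

Lemma enc_inj : injective enc.
Proof.
move=> x y; case: (rvertP x) => [v|u i lei]; case: (rvertP y) => [v'|u' j lej].
- by move=> /val_inj ->.
- by rewrite enc_pos // => e; have := leq_cpos u' j; rewrite -e cnVE leqNgt ltn_ord.
- by rewrite enc_pos // => e; have := leq_cpos u i; rewrite e cnVE leqNgt ltn_ord.
rewrite !enc_pos // => e.
have lti : i < K by apply: leq_ltn_trans (ltK u).
have ltj : j < K by apply: leq_ltn_trans (ltK u').
have eu : u = u' by have := f_equal (curp q K) e; rewrite !curp_cpos // => /val_inj.
by subst u'; rewrite -(cidx_cpos u lti) e cidx_cpos.
Qed.

Lemma ends_lt (u : 'I_(pg_nU P)) : u < size (pg_ends P).
Proof. by case/and5P: wfP => _ _ _ /eqP-> _; apply: ltn_ord. Qed.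

Lemma catendE (v : 'I_(pg_nV P)) u i : i <= m u ->
  catend q K mc v (cpos q K u i) = base_adj P m (inl v) (rpos m u i).
Proof.
move=> lei; have lti : i < K by apply: leq_ltn_trans (ltK u).
by rewrite /catend curp_cpos // cidx_cpos // mcE base_vpos // cend1E ?cend2E ?ends_lt.
Qed.

Lemma cbaseE x y : cbase q K mc (enc x) (enc y) = base_adj P m x y.
Proof.
have ltv (v : 'I_(pg_nV P)) : (v < cnV q) * ((cnV q <= v) = false).
  have h : v < cnV q by rewrite cnVE.
  by split; rewrite // leqNgt h.
have gep u i : ((cpos q K u i < cnV q) = false) * (cnV q <= cpos q K u i).
  by split; rewrite ?ltnNge leq_cpos.
rewrite /cbase; case: (rvertP x) => [v|u i lei]; case: (rvertP y) => [v'|u' j lej].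
- by rewrite !ltv !andbF !orbF /= cedgeE.
- by rewrite enc_pos // !ltv !gep /= !orbF catendE.
- by rewrite enc_pos // !ltv !gep /= !orbF catendE // base_adj_sym.
have lti : i < K by apply: leq_ltn_trans (ltK u).
have ltj : j < K by apply: leq_ltn_trans (ltK u').
by rewrite base_pospos // !enc_pos // !gep /= !curp_cpos // !cidx_cpos.
Qed.

Lemma cextraE x y : cextra q K (enc x) (enc y) = extra_ok P m x y.
Proof.
have ltv (v : 'I_(pg_nV P)) : (v < cnV q) * ((cnV q <= v) = false).
  have h : v < cnV q by rewrite cnVE.
  by split; rewrite // leqNgt h.
have gep u i : ((cpos q K u i < cnV q) = false) * (cnV q <= cpos q K u i).
  by split; rewrite ?ltnNge leq_cpos.
rewrite /cextra; case: (rvertP x) => [v|u i lei]; case: (rvertP y) => [v'|u' j lej].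
- by rewrite !ltv.
- have ltj : j < K by apply: leq_ltn_trans (ltK u').
  by rewrite enc_pos // !ltv !gep /= !orbF curp_cpos // cspokeE.
- have lti : i < K by apply: leq_ltn_trans (ltK u).
  by rewrite enc_pos // !ltv !gep /= !orbF curp_cpos // cspokeE.
have lti : i < K by apply: leq_ltn_trans (ltK u).
have ltj : j < K by apply: leq_ltn_trans (ltK u').
by rewrite !enc_pos // !gep /= !curp_cpos // crungE.
Qed.

Lemma creal_localP rc : reflect
  (forall x y, clocal q K mc rc (enc x) (enc y)) (creal_local q K mc rc).
Proof.
apply: (iffP (ballP _ _)) => [h x y|h a lta].
  have /ballP/(_ _ (enc_lt y))/implyP := h _ (enc_lt x).
  by apply; rewrite !cvalid_enc.
apply/ballP=> b ltb; apply/implyP=> /andP[/enc_onto[x <-] /enc_onto[y <-]].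
exact: h.
Qed.

Section Relation.

Variables (r : rel (rvert P m)) (rc : nat).
Hypothesis rcE : forall x y, r x y = crel (csize q K) rc (enc x) (enc y).

Lemma crealP : reflect (is_realization P m r) (creal q K mc rc).
Proof.
have clocalE x y : clocal q K mc rc (enc x) (enc y) =
    [&& r x y == r y x, ~~ r x x, base_adj P m x y ==> r x y &
        r x y ==> base_adj P m x y || extra_ok P m x y].
  by rewrite /clocal cbaseE cextraE !rcE.
have posE u (i : 'I_(m u).+1) : inr (existT _ u i) = rpos m u i by rewrite /rpos inord_val.
have le_m u (i : 'I_(m u).+1) : i <= m u by rewrite -ltnS.
have ltm u i : i <= m u -> i < K by move=> lei; apply: leq_ltn_trans (ltK u).
rewrite /creal; apply: (iffP and3P).
  case=> /creal_localP loc /ballP spk /ballP rng; split.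
  - by split=> [x y|x]; [have := loc x y | have := loc x x];
      rewrite clocalE => /and4P[/eqP ? ? _ _].
  - by move=> x y; have := loc x y; rewrite clocalE => /and4P[_ _ /implyP].
  - by move=> x y; have := loc x y; rewrite clocalE => /and4P[_ _ _ /implyP].
  - move=> v u sp; have ltv : v < cnV q by rewrite cnVE.
    have ltu : u < cnU q by rewrite cnUE.
    have /ballP/(_ _ ltu)/implyP := spk _ ltv.
    rewrite cspokeE => /(_ sp)/bexP[i _ /and3P[lei h1 h2]]; rewrite mcE in lei.
    exists (inord i); rewrite -/(rpos m u i) rcE -cbaseE enc_pos //.
    by rewrite h1 h2.
  move=> u u' rg; have ltu : u < cnU q by rewrite cnUE.
  have ltu' : u' < cnU q by rewrite cnUE.
  have /ballP/(_ _ ltu')/implyP := rng _ ltu.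
  rewrite crungE => /(_ rg)/bexP[i _ /bexP[j _ /and3P[lei lej h]]]; rewrite !mcE in lei lej.
  by exists (inord i), (inord j); rewrite -/(rpos m u i) -/(rpos m u' j) rcE !enc_pos.
case=> -[rsym rirr] rbase rextra rspoke rrung; split.
- apply/creal_localP=> x y; rewrite clocalE rsym eqxx rirr /=.
  by apply/andP; split; apply/implyP; [rewrite rsym; apply: rbase | rewrite rsym; apply: rextra].
- apply/ballP=> a; rewrite cnVE => lta; apply/ballP=> b; rewrite cnUE => ltb; apply/implyP.
  rewrite cspokeE => /(rspoke (Ordinal lta) (Ordinal ltb))[i].
  rewrite posE rcE -cbaseE enc_pos // => /andP[h1 h2]; apply/bexP; exists i.
    exact: ltm (le_m _ i).
  by have -> := mcE (Ordinal ltb); rewrite le_m /=; apply/andP.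
apply/ballP=> a; rewrite cnUE => lta; apply/ballP=> b ltb; apply/implyP.
rewrite crungE => /(rrung (Ordinal lta) (Ordinal ltb))[i [j]].
rewrite !posE rcE !enc_pos // => h; apply/bexP; exists i; first exact: ltm (le_m _ i).
apply/bexP; exists j; first exact: ltm (le_m _ j).
by have -> := mcE (Ordinal ltb); have -> := mcE (Ordinal lta); rewrite !le_m.
Qed.

End Relation.

Lemma crel_exists (r : rel (rvert P m)) :
  exists2 rc, rc < 2 ^ (csize q K * csize q K) &
    forall x y, r x y = crel (csize q K) rc (enc x) (enc y).
Proof.
pose f n : nat := [exists x, exists y, [&& enc x == n %/ csize q K, enc y == n %% csize q K & r x y]].
have [|rc ltrc rcP] := @cdig_exists 2 (csize q K * csize q K) f.
  by move=> i _; rewrite /f; case: [exists _, _].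
exists rc => // x y; have ltx := enc_lt x; have lty := enc_lt y.
have Z_gt0 : 0 < csize q K by apply: leq_ltn_trans lty.
rewrite /crel rcP; last first.
  apply: (@leq_trans ((enc x).+1 * csize q K)); last by rewrite leq_mul2r ltx orbT.
  by rewrite mulSn addnC ltn_add2r.
rewrite /f eqb1 divnMDl // divn_small // addn0 modnMDl modn_small //.
apply/idP/existsP=> [rxy|[x1 /existsP[y1 /and3P[/eqP/enc_inj-> /eqP/enc_inj->]]] //].
by exists x; apply/existsP; exists y; rewrite !eqxx.
Qed.

Lemma cfun_exists b (F : rvert P m -> nat) : (forall x, F x < b.+1) ->
  exists2 fc, fc < b.+1 ^ csize q K & forall x, cdig b.+1 fc (enc x) = F x.
Proof.
move=> ltF.
pose f n := if [pick x | enc x == n] is Some x then F x else 0.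
have [|fc ltfc fcP] := @cdig_exists b.+1 (csize q K) f.
  by move=> i _; rewrite /f; case: pickP.
exists fc => // x; rewrite fcP ?enc_lt // /f.
by case: pickP => [y /eqP/enc_inj->|/(_ x)] //; rewrite eqxx.
Qed.

End Encoding.

(** * Correctness of the decision procedure *)

Lemma clengths_exists n K (m : 'I_n -> nat) : (forall u, m u < K.+1) ->
  exists2 mc, mc < K.+1 ^ n & forall u : 'I_n, cdig K.+1 mc u = m u.
Proof.
move=> ltm; have [|mc ltmc mcP] := @cdig_exists K.+1 n (fun i => oapp m 0 (insub i)).
  by move=> i lti; rewrite insubT /=.
by exists mc => // u; rewrite mcP // valK.
Qed.

Lemma ccontP (H Q : pathograph) (m : 'I_(pg_nU H) -> nat) (r : rel (rvert H m)) (K mc rc : nat) :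
    wf_pg Q -> (forall u, m u < K) -> (forall u : 'I_(pg_nU H), cdig K mc u = m u) ->
    (forall x y, r x y = crel (csize (pg_code H) K) rc (enc K x) (enc K y)) ->
  reflect (contains (rvert H m) r Q) (ccont (pg_code Q) (pg_code H) K mc rc).
Proof.
move=> wfQ ltK mcE rcE; set h := pg_code H; set q := pg_code Q.
pose Z := csize h K; apply: (iffP (bexP _ _)).
  case=> mc' _ /bexP[rc' _ /bexP[fc _ /andP[real /ballP emb]]].
  pose m' (u : 'I_(pg_nU Q)) := cdig Z.+1 mc' u.
  have ltK' u : m' u < Z.+1 by rewrite ltn_mod.
  have mcE' (u : 'I_(pg_nU Q)) : cdig Z.+1 mc' u = m' u by [].
  have embP (x y : rvert Q m') :
      [/\ cvalid h K mc (cdig Z.+1 fc (enc Z.+1 x)),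
          crel (csize q Z.+1) rc' (enc Z.+1 x) (enc Z.+1 y) =
          crel Z rc (cdig Z.+1 fc (enc Z.+1 x)) (cdig Z.+1 fc (enc Z.+1 y)) &
          cdig Z.+1 fc (enc Z.+1 x) = cdig Z.+1 fc (enc Z.+1 y) -> x = y].
    have /ballP/(_ _ (enc_lt ltK' y))/implyP := emb _ (enc_lt ltK' x).
    rewrite !(cvalid_enc ltK' mcE') => /(_ isT)/and3P[h1 /eqP h2 /implyP h3].
    by split=> // /eqP/h3/eqP/(enc_inj ltK').
  have /fin_all_exists[f fP] (x : rvert Q m') : exists y : rvert H m,
      enc K y = cdig Z.+1 fc (enc Z.+1 x).
    by have [/(enc_onto mcE)] := embP x x.
  exists m', (fun x y => crel (csize q Z.+1) rc' (enc Z.+1 x) (enc Z.+1 y)); split.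
    by apply: (crealP wfQ ltK' mcE' _ real).
  exists f; split=> [x y fxy|x y].
    by have [_ _] := embP x y; apply; rewrite -!fP fxy.
  by have [_ -> _] := embP x y; rewrite rcE !fP.
case=> m' [r' [real [f [finj ef]]]].
(* The [m' u + 1] internal vertices of [u] have images with distinct codes below [Z]. *)
have ltK' u : m' u < Z.+1.
  rewrite ltnS ltnW //.
  have := @uniq_leq_size _ [seq enc K (f (rpos m' u i)) | i <- iota 0 (m' u).+1] (iota 0 Z).
  rewrite size_map !size_iota; apply.
    rewrite map_inj_in_uniq ?iota_uniq // => i j.
    rewrite !mem_iota /= !add0n !ltnS => lei lej /(enc_inj ltK)/finj.
    by case/(rpos_inj lei lej).
  by move=> _ /mapP[i _ ->]; rewrite mem_iota /= add0n; apply: (enc_lt ltK).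
have [mc' ltmc' mcE'] := clengths_exists ltK'.
have [rc' ltrc' rcE'] := crel_exists ltK' r'.
have [|fc ltfc fcE] := @cfun_exists Q m' Z.+1 ltK' Z (fun x => enc K (f x)).
  by move=> x; apply: leqW; apply: (enc_lt ltK).
exists mc'; first by rewrite cnUE.
apply/bexP; exists rc' => //; apply/bexP; exists fc => //; apply/andP; split.
  by apply/(crealP wfQ ltK' mcE' rcE').
apply/ballP=> a _; apply/ballP=> b _; apply/implyP.
case/andP=> /(enc_onto mcE')[x <-] /(enc_onto mcE')[y <-].
rewrite !fcE (cvalid_enc ltK mcE) -rcE' -rcE ef eqxx /=.
by apply/implyP=> /eqP/(enc_inj ltK)/finj->.
Qed.

Lemma In_nth (T : Type) (x0 x : T) (s : seq T) :
  List.In x s <-> exists2 i, i < size s & nth x0 s i = x.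
Proof.
split.
  elim: s => //= y s IH [<-|/IH[i lti <-]]; first by exists 0.
  by exists i.+1.
case=> i + <-; elim: s i => //= y s IH [|i] lti; first by left.
by right; apply: IH.
Qed.

(** The code of a list is at least its length, so it can bound the index; a zero [cdrop] discards
    indices past the end. *)
Lemma Ffree_codes (T : Type) (e : rel T) (F : seq pathograph) (D : pred nat) :
    all wf_pg F -> (forall Q, wf_pg Q -> reflect (contains T e Q) (D (pg_code Q))) ->
  reflect (Ffree T e F)
    (ball (pg_codes F) (fun i => (cdrop i (pg_codes F) != 0) ==> ~~ D (celt (pg_codes F) i))).
Proof.
move=> wfF DP; pose Q0 := Pathograph 0 0 [::] [::] [::] [::].
have codesE : pg_codes F = CodeSeq.code (map pg_code F).
  by rewrite /pg_codes -[in RHS](map_id (map pg_code F)).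
have dropE i : (cdrop i (pg_codes F) != 0) = (i < size F).
  by rewrite codesE cdrop_code code_eq0 /nilp size_drop size_map subn_eq0 -ltnNge.
have eltE i : i < size F -> celt (pg_codes F) i = pg_code (nth Q0 F i).
  by move=> lti; rewrite codesE celt_code (nth_map Q0).
apply: (iffP (ballP _ _)) => [free Q /[dup] /(all_In wfF) wfQ|free i _].
  move=> /(In_nth Q0)[i lti eQ] /(DP _ wfQ) dQ.
  have lti' : i < pg_codes F.
    by apply: leq_trans lti _; rewrite codesE -(size_map pg_code F) size_code.
  have := free i lti'; rewrite dropE lti eltE // eQ /=; exact/negP/negPn.
rewrite dropE; apply/implyP=> lti; rewrite eltE //.
have QF : List.In (nth Q0 F i) F by apply/(In_nth Q0); exists i.
by apply/negP=> /(DP _ (all_In wfF QF)); apply: free.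
Qed.

Lemma cdecideP (H : pathograph) (F : seq pathograph) :
    wf_pg H -> all wf_pg F -> pg_rungs H = [::] ->
  reflect (has_Ffree_realization H F) (cdecide (pg_code H) (pg_codes F)).
Proof.
move=> wfH wfF norung; rewrite /cdecide; set C := _ + _; set B := cbound C.
apply: (iffP (bexP _ _)).
  case=> mc _ /bexP[rc _ /andP[real free]].
  pose m (u : 'I_(pg_nU H)) := cdig B.+1 mc u.
  have ltm u : m u < B.+1 by rewrite ltn_mod.
  have mcE (u : 'I_(pg_nU H)) : cdig B.+1 mc u = m u by [].
  pose r (x y : rvert H m) := crel (csize (pg_code H) B.+1) rc (enc B.+1 x) (enc B.+1 y).
  exists m, r; split; first by apply: (crealP wfH ltm mcE _ real).
  apply: (Ffree_codes (D := fun q => ccont q _ _ mc rc) wfF _ free) => Q wfQ.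
  exact: (ccontP wfQ ltm mcE (fun _ _ => erefl)).
have leC Q : List.In Q F -> mark_bound (pg_nV H) (pg_nV Q) (pg_nU Q) <= cmarks C.
  move=> QF; have leQ : pg_code Q <= pg_codes F.
    have [i lti <-] := (In_nth Q Q F).1 QF.
    have /allP/(_ (pg_code (nth Q F i))) := CodeSeq.ltn_code (map pg_code F).
    rewrite -(nth_map _ 0) ?mem_nth ?size_map // => /(_ isT)/ltnW.
    by rewrite /pg_codes -[in X in _ <= X -> _](map_id (map pg_code F)).
  have lh := nV_leq_code H; have lk := nV_leq_code Q; have ll := nU_leq_code Q.
  have kC : pg_nV Q <= C by rewrite /C; lia.
  have lC : pg_nU Q <= C by rewrite /C; lia.
  have nC : pg_nV H <= C by rewrite /C; lia.
  by rewrite /mark_bound /cmarks; have := leq_mul kC lC; have := leq_mul lC lC; lia.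
(* Completeness: a realization of arbitrary lengths is first replaced by one that the search
   reaches. *)
move=> has; have [m [r [real free ltm]]] := bounded_realization wfH wfF norung leC has.
have {}ltm u : m u < B.+1.
  rewrite ltnS (leq_trans (ltm u)) // /profile_count /B /cbound.
  have nC : pg_nV H <= C by rewrite /C (leq_trans (nV_leq_code H)) // leq_addr.
  by rewrite !(leq_exp2l, leq_mul2l, leq_mul2r) // nC !orbT.
have [mc ltmc mcE] := clengths_exists ltm.
have [rc ltrc rcE] := crel_exists ltm r.
exists mc; first by rewrite cnUE.
apply/bexP; exists rc => //; apply/andP; split; first by apply/(crealP wfH ltm mcE rcE).
apply/(Ffree_codes (D := fun q => ccont q _ _ mc rc) wfF _ : reflect (Ffree _ r F) _) => // Q wfQ.
exact: (ccontP wfQ ltm mcE rcE).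
Qed.

(* There is a mu-recursive function (an algorithm) which, on input the codes  *)
(* of a rung-free pathograph H and of a finite list F of pathographs, halts   *)
(* with output 1 iff H has an F-free realization (and some other value      *)
(* otherwise).                                                               *)
Theorem theorem3 :
  exists p : prf,
    forall (H : pathograph) (F : seq pathograph),
      wf_pg H -> all wf_pg F -> pg_rungs H = [::] ->
      exists b : nat,
        eval p [:: pg_code H; pg_codes F] b /\
        (b = 1 <-> has_Ffree_realization H F).
Proof.
have [p hp] : Comp 2 (fun xs => cdecide (nth 0 xs 0) (nth 0 xs 1)) by comp.
exists p => H F wfH wfF norung; exists (cdecide (pg_code H) (pg_codes F)).
split; first exact: (hp [:: _; _]).
by case: cdecideP => // h; split.
Qed.
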